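(* Suppose $\boldsymbol{X}\in[q]^N$ is an observation from the Potts model $\mathbb{P}_{\beta,\boldsymbol{B}}$ with $(\beta,\boldsymbol{B})\in(0,\infty)\times\mathbb{R}^{q-1}$, where the interaction matrix $\boldsymbol{A}_N$ satisfies $$\sup_{N\ge1}\max_{i\in[N]}\sum_{j=1}^Na_{ij}<\infty,\qquad \liminf_{N\to\infty}\frac1N\sum_{1\le i,j\le N}a_{ij}>0,\qquad \liminf_{N\to\infty}\frac1N\sum_{1\le i,j\le N}a_{ij}^2>0.$$ Then the MPL estimator satisfies $$\|(\hat\beta_N-\beta,\hat{\boldsymbol{B}}_N-\boldsymbol{B})\|_2=O_{\mathbb{P}}\left(\frac1{\sqrt N}\right).$$
   Context: Fix an integer $q\ge2$ and write $[m]=\{1,\dots,m\}$. For each $N$, $\boldsymbol{A}_N=((a_{ij}))_{1\le i,j\le N}$ is a known deterministic symmetric matrix with zero diagonal and non-negative entries. For $\beta>0$ and $\boldsymbol{B}=(B_1,\dots,B_{q-1})\in\mathbb{R}^{q-1}$, with the convention $B_q:=0$, the Potts model is the probability mass function on $[q]^N$ $$\mathbb{P}_{\beta,\boldsymbol{B}}(\boldsymbol{x})=\frac{1}{Z_N(\beta,\boldsymbol{B})}\exp\Big(\frac\beta2\sum_{1\le i,j\le N}a_{ij}\mathbf 1_{x_i=x_j}+\sum_{i=1}^N\sum_{r=1}^qB_r\mathbf 1_{x_i=r}\Big),$$ where $Z_N(\beta,\boldsymbol{B})$ is the normalizing constant. For $\boldsymbol{x}\in[q]^N$ let $m_{i,r}(\boldsymbol{x}):=\sum_{j=1}^Na_{ij}\mathbf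 1_{x_j=r}$. The log pseudo-likelihood is, for $(\beta,\boldsymbol{B})\in\mathbb{R}^q$ (with $B_q:=0$), $$\ell_N(\beta,\boldsymbol{B}):=\beta\sum_{i=1}^N\sum_{r=1}^qm_{i,r}(\boldsymbol{X})\mathbf 1_{X_i=r}+\sum_{i=1}^N\sum_{r=1}^qB_r\mathbf 1_{X_i=r}-\sum_{i=1}^N\log\Big(\sum_{r=1}^q\exp\{\beta m_{i,r}(\boldsymbol{X})+B_r\}\Big).$$ The maximum pseudo-likelihood (MPL) estimator $(\hat\beta_N,\hat{\boldsymbol{B}}_N)$ is the unique maximizer of $\ell_N$ over $\mathbb{R}^q$ when a unique maximizer exists (where it does not exist it may be assigned an arbitrary value). $O_{\mathbb{P}}$ is as $N\to\infty$ under the true law $\mathbb{P}_{\beta,\boldsymbol{B}}$. *)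

(* Defs.v *)
From mathcomp Require Import all_boot all_order all_algebra.
From mathcomp Require Import all_classical all_reals all_analysis.

Set Implicit Arguments.
Unset Strict Implicit.
Unset Printing Implicit Defensive.

Import Order.TTheory GRing.Theory Num.Theory.
Import numFieldNormedType.Exports.

Local Open Scope classical_set_scope.
Local Open Scope ring_scope.

(* The colors 1, ..., q are represented by 'I_q = {0, ..., q - 1}; the
   color q is the ordinal of value q - 1. *)
Definition config (q N : nat) := {ffun 'I_N -> 'I_q}.

Definition params (R : realType) (q : nat) := (R * 'rV[R]_(q.-1))%type.

(* B_r for r in [q], with the convention B_q := 0: [insub] fails exactly on the
   last color. *)
Definition ext_field (R : realType) (q : nat) (B : 'rV[R]_(q.-1)) (r : 'I_q) : R :=
  if insub (val r) is Some j then B ord0 j else 0.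

Definition potts_weight (R : realType) (q N : nat) (A : 'M[R]_N)
    (t : params R q) (x : config q N) : R :=
  expR (t.1 / 2 * (\sum_(i < N) \sum_(j < N) A i j * (x i == x j)%:R)
        + \sum_(i < N) \sum_(r < q) ext_field t.2 r * (x i == r)%:R).

Definition potts_Z (R : realType) (q N : nat) (A : 'M[R]_N)
    (t : params R q) : R :=
  \sum_(x : config q N) potts_weight A t x.

Definition potts (R : realType) (q N : nat) (A : 'M[R]_N)
    (t : params R q) (x : config q N) : R :=
  potts_weight A t x / potts_Z A t.

Definition local_field (R : realType) (q N : nat) (A : 'M[R]_N)
    (x : config q N) (i : 'I_N) (r : 'I_q) : R :=
  \sum_(j < N) A i j * (x j == r)%:R.

Definition log_pseudolikelihood (R : realType) (q N : nat) (A : 'M[R]_N)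
    (x : config q N) (t : params R q) : R :=
  t.1 * (\sum_(i < N) \sum_(r < q) local_field A x i r * (x i == r)%:R)
  + \sum_(i < N) \sum_(r < q) ext_field t.2 r * (x i == r)%:R
  - \sum_(i < N) ln (\sum_(r < q) expR (t.1 * local_field A x i r
                                        + ext_field t.2 r)).

Definition maximizer (R : realType) (T : Type) (f : T -> R) (t : T) : Prop :=
  forall u, f u <= f t.

Definition unique_maximizer (R : realType) (T : Type) (f : T -> R) (t : T)
    : Prop :=
  maximizer f t /\ forall u, maximizer f u -> u = t.

(* The value of the estimator is unconstrained on the samples for which the
   log pseudo-likelihood has no unique maximizer. *)
Definition is_MPL_estimator (R : realType) (q : nat) (A : forall N, 'M[R]_N)
    (est : forall N, config q N -> params R q) : Prop :=
  forall N (x : config q N) (t : params R q),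
    unique_maximizer (log_pseudolikelihood (A N) x) t -> est N x = t.

(* The library's norms on pairs and on matrices are sup norms. *)
Definition norm2 (R : realType) (q : nat) (t : params R q) : R :=
  Num.sqrt (t.1 ^+ 2 + \sum_(r < q.-1) t.2 ord0 r ^+ 2).

(* Y_N = O_P(rho_N), where Y_N lives on the finite space T N with probability
   mass function P N. *)
Definition bigO_proba (R : realType) (T : nat -> finType)
    (P Y : forall N, T N -> R) (rho : nat -> R) : Prop :=
  forall eps : R, 0 < eps -> exists2 K : R, 0 < K &
    \forall N \near \oo,
      \sum_(x : T N | K * `|rho N| < `|Y N x|) P N x <= eps.

(* Main.v *)
(* For w = (u, v) put f_i(r) = u m_{i,r} + v_r. The increment of the log
   pseudo-likelihood from the truth theta to theta + w is the sum over i of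
   f_i(x_i) - log E_i exp(f_i), where E_i is the mean under the law of x_i given
   the other coordinates. For small w, log E e^f >= E f + Var f / 8, so the
   increment is at most score(w) - (1/8) sum_i Var_i(f_i).

   Both terms are controlled by one second moment bound, valid at every beta:
   residuals h_i - E_{J(i)} h_i are nearly orthogonal, because such a residual is
   orthogonal to whatever does not depend on the coordinate J(i) and, the row sums
   of A being bounded, each residual depends weakly on most coordinates. With J(i) = i it
   shows that the score is O(N^(1/2)).

   For the variances, let D_i = m_{i,1} - m_{i,q}. As sum a_ij^2 >= c N and the
   row sums are bounded, a positive fraction of the i have a neighbour J(i) with
   a_{i,J(i)} >= eta; resampling x_{J(i)} alone gives u D_i + v a conditional
   second moment of order u^2, uniformly in v. Up to an error o(N), by the second
   moment bound, sum_i (u D_i + v)^2 is thus at least of order N u^2, which makes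
   sum_i Var_i(f_i) at least of order N |w|^2. Hence the increment is negative on a
   sphere of radius of order N^(-1/2), and concavity does the rest. *)
Require Import Defs.
From mathcomp Require Import all_boot all_order all_algebra.
From mathcomp Require Import all_classical all_reals all_analysis.
From mathcomp Require Import ring lra.

Set Implicit Arguments.
Unset Strict Implicit.
Unset Printing Implicit Defensive.

Import Order.TTheory GRing.Theory Num.Theory.
Import numFieldNormedType.Exports.

Local Open Scope classical_set_scope.
Local Open Scope ring_scope.

(** * Exponential moments and the softmax *)

Section MomentGenerating.
Context {R : realType} {T : finType} (p : T -> R).
Hypothesis p_ge0 : forall r, 0 <= p r.
Hypothesis p_sum : \sum_r p r = 1.
Implicit Type f : T -> R.

Definition mean f : R := \sum_r p r * f r.

Definition variance f : R := \sum_r p r * (f r - mean f) ^+ 2.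

Lemma meanD f g : mean (fun r => f r + g r) = mean f + mean g.
Proof. by rewrite /mean -big_split; apply: eq_bigr => r _; rewrite mulrDr. Qed.

Lemma meanZ c f : mean (fun r => c * f r) = c * mean f.
Proof. by rewrite /mean big_distrr; apply: eq_bigr => r _; rewrite mulrCA. Qed.

Lemma mean_cst c : mean (fun=> c) = c.
Proof. by rewrite /mean -big_distrl /= p_sum mul1r. Qed.

Lemma le_mean f g : (forall r, f r <= g r) -> mean f <= mean g.
Proof. by move=> fg; apply: ler_sum => r _; rewrite ler_wpM2l. Qed.

Lemma mean_norm_le f M : (forall r, `|f r| <= M) -> `|mean f| <= M.
Proof.
move=> fM; rewrite ler_norml -{1}(mean_cst M) -{2}(mean_cst M).
apply/andP; split; last first.
  by apply: le_mean => r; have := fM r; rewrite ler_norml => /andP[].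
rewrite -mulN1r -meanZ; apply: le_mean => r.
by rewrite mulN1r; have := fM r; rewrite ler_norml => /andP[].
Qed.

Lemma mean_centered f : mean (fun r => 1 + (f r - mean f)) = 1.
Proof.
by rewrite meanD mean_cst (meanD f (fun=> - mean f)) mean_cst subrr addr0.
Qed.

Lemma mean_expR_center f :
  mean (fun r => expR (f r)) = expR (mean f) * mean (fun r => expR (f r - mean f)).
Proof.
rewrite -meanZ; apply: eq_bigr => r _.
by rewrite -expRD subrKC.
Qed.

Lemma ln_mean_expR f : 0 < mean (fun r => expR (f r - mean f)) ->
  ln (mean (fun r => expR (f r))) =
  mean f + ln (mean (fun r => expR (f r - mean f))).
Proof.
by move=> gt0; rewrite mean_expR_center lnM ?posrE ?expR_gt0// expRK.
Qed.

Lemma mean_expR_center_ge1 f : 1 <= mean (fun r => expR (f r - mean f)).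
Proof.
by rewrite -(mean_centered f); apply: le_mean => r; exact: expR_ge1Dx.
Qed.

Lemma mean_le_ln_mean_expR f : mean f <= ln (mean (fun r => expR (f r))).
Proof.
have ge1 := mean_expR_center_ge1 f.
by rewrite ln_mean_expR ?(lt_le_trans ltr01)// lerDl ln_ge0.
Qed.

(** A non-constant [f] differs from its mean at some point. This point has positive mass, and there
    e^y > 1 + y is strict. *)
Lemma mean_lt_ln_mean_expR f r s : (forall t, 0 < p t) -> f r != f s ->
  mean f < ln (mean (fun t => expR (f t))).
Proof.
move=> p_gt0 frs.
have ge1 := mean_expR_center_ge1 f.
rewrite ln_mean_expR ?(lt_le_trans ltr01)// ltrDl ln_gt0// -(mean_centered f).
have [t ft] : exists t, f t != mean f.
  case: (eqVneq (f r) (mean f)) => [frE|]; last by exists r.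
  by exists s; rewrite -frE eq_sym.
rewrite /mean (bigD1 t)//= [ltRHS](bigD1 t)//=; apply: ltr_leD.
  by rewrite ltr_pM2l//; apply: expR_gt1Dx; rewrite subr_eq0.
by apply: ler_sum => t' _; rewrite ler_wpM2l//; exact: expR_ge1Dx.
Qed.

Lemma variance_ge0 f : 0 <= variance f.
Proof. by apply: sumr_ge0 => r _; rewrite mulr_ge0// sqr_ge0. Qed.

(** The centered function g = f - E f lies in [-2, 2], so e^g dominates the square (1 + g/2)^2,
    whose mean is 1 + V/4 with V the variance. *)
Lemma mean_variance_le_ln_mean_expR f : (forall r, `|f r| <= 1) ->
  mean f + variance f / 8 <= ln (mean (fun r => expR (f r))).
Proof.
move=> f1.
have m1 := mean_norm_le f1.
have g2 r : -2 <= f r - mean f <= 2.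
  by have := f1 r; move: m1; rewrite !ler_norml => /andP[? ?] /andP[? ?]; lra.
have ge1 := mean_expR_center_ge1 f.
rewrite ln_mean_expR ?(lt_le_trans ltr01)// lerD2l.
set V := variance f.
have V0 : 0 <= V by exact: variance_ge0.
have V4 : V <= 4.
  rewrite -[leRHS](mean_cst 4); apply: le_mean => r.
  move: (g2 r); set g := f r - mean f => /andP[gl gu].
  have : 0 <= (2 - g) * (2 + g) by rewrite mulr_ge0//; lra.
  by nra.
have geV : 1 + V / 4 <= mean (fun r => expR (f r - mean f)).
  have -> : 1 + V / 4 =
      mean (fun r => (1 + (f r - mean f)) + 4^-1 * (f r - mean f) ^+ 2).
    rewrite meanD mean_centered meanZ; congr (_ + _); by rewrite mulrC.
  apply: le_mean => r; set g := f r - mean f.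
  (* e^g = (e^(g/2))^2 >= (1 + g/2)^2, valid because 1 + g/2 >= 0 *)
  have -> : expR g = expR (g / 2) ^+ 2 by rewrite -expRM_natl; congr expR; field.
  have h := expR_ge1Dx (g / 2).
  move: (g2 r); rewrite -/g => /andP[gl gu].
  have : 0 <= (expR (g / 2) - (1 + g / 2)) * (expR (g / 2) + (1 + g / 2)).
    by rewrite mulr_ge0//; lra.
  by nra.
rewrite -[leLHS]expRK ler_ln ?posrE ?expR_gt0 ?(lt_le_trans ltr01)//.
apply: le_trans geV.
(* e^(V/8) <= 1/(1 - V/8) <= 1 + V/4; the second inequality uses V <= 4. *)
have h : 1 - V / 8 <= (expR (V / 8))^-1 by rewrite -expRN; exact: expR_ge1Dx.
have e0 := expR_gt0 (V / 8).
have : (1 - V / 8) * expR (V / 8) <= 1 by rewrite -ler_pdivlMr// mul1r.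
by nra.
Qed.

(** The two points [r] and [s] carry mass at least [c] each, and a^2 + b^2 >= (a - b)^2 / 2
    eliminates the mean. *)
Lemma variance_ge f c r s : (forall t, c <= p t) -> 0 <= c ->
  c / 2 * (f r - f s) ^+ 2 <= variance f.
Proof.
move=> cp c0; case: (eqVneq r s) => [->|rs].
  by rewrite subrr expr0n mulr0 variance_ge0.
rewrite /variance (bigD1 r)//= (bigD1 s) 1?eq_sym//= addrA.
rewrite -[leLHS]addr0 lerD ?sumr_ge0//; last first.
  by move=> t _; rewrite mulr_ge0 ?sqr_ge0.
set m := mean f.
apply: (@le_trans _ _ (c * (f r - m) ^+ 2 + c * (f s - m) ^+ 2)).
  rewrite -mulrDr -mulrA ler_wpM2l//.
  have := sqr_ge0 ((f r - m) + (f s - m)); nra.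
by rewrite lerD// ler_wpM2r ?sqr_ge0.
Qed.

End MomentGenerating.

(** * Log-sum-exp and the softmax law *)

Section Softmax.
Context {R : realType} {T : finType} (t0 : T).
Implicit Type a f : T -> R.

Definition lse a : R := ln (\sum_r expR (a r)).

Definition softmax a (r : T) : R := expR (a r) / \sum_s expR (a s).

Lemma sum_expR_gt0 a : 0 < \sum_r expR (a r).
Proof.
rewrite (bigD1 t0)//= ltr_wpDr ?expR_gt0//.
by apply: sumr_ge0 => r _; exact: expR_ge0.
Qed.

Lemma softmax_gt0 a r : 0 < softmax a r.
Proof. by rewrite divr_gt0 ?expR_gt0 ?sum_expR_gt0. Qed.

Lemma softmax_ge0 a r : 0 <= softmax a r.
Proof. exact/ltW/softmax_gt0. Qed.

Lemma softmax_sum a : \sum_r softmax a r = 1.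
Proof. by rewrite -mulr_suml divff// gt_eqF// sum_expR_gt0. Qed.

(** Exponential tilting: an increment of log-sum-exp is the log of an exponential moment under the
    softmax law, to which the bounds above apply. *)
Lemma lseD a f :
  lse (fun r => a r + f r) = lse a + ln (mean (softmax a) (fun r => expR (f r))).
Proof.
rewrite /lse -lnM ?posrE ?sum_expR_gt0//; last first.
  rewrite /mean (bigD1 t0)//= ltr_wpDr//.
    by apply: sumr_ge0 => r _; rewrite mulr_ge0 ?softmax_ge0 ?expR_ge0.
  by rewrite mulr_gt0 ?softmax_gt0 ?expR_gt0.
congr ln; rewrite /mean big_distrr/=; apply: eq_bigr => r _.
by rewrite expRD /softmax mulrA mulrCA divff ?mulr1// gt_eqF// sum_expR_gt0.
Qed.

(** The numerator and the normalizing sum each change by a factor of at most e^d. *)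
Lemma softmax_le_expR a b d r : (forall s, `|a s - b s| <= d) ->
  softmax a r <= softmax b r * expR (2 * d).
Proof.
move=> abd; rewrite /softmax ler_pdivrMr ?sum_expR_gt0//.
have abE s : expR (a s) <= expR (b s) * expR d.
  by rewrite -expRD ler_expR; have := abd s; rewrite ler_norml => /andP[? ?]; lra.
have baE s : expR (b s) <= expR (a s) * expR d.
  by rewrite -expRD ler_expR; have := abd s; rewrite ler_norml => /andP[? ?]; lra.
set Sa := \sum_s expR (a s); set Sb := \sum_s expR (b s).
have Sb0 : 0 < Sb by exact: sum_expR_gt0.
have -> : expR (b r) / Sb * expR (2 * d) * Sa =
    (expR (b r) * expR d) * (Sa * expR d / Sb).
  by rewrite mulr_natl mulr2n expRD; ring.
rewrite -[leLHS]mulr1 ler_pM ?expR_ge0// ler_pdivlMr// mul1r.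
by rewrite /Sa big_distrl/=; apply: ler_sum => s _.
Qed.

Lemma softmax_le1 a r : softmax a r <= 1.
Proof.
rewrite -(softmax_sum a) (bigD1 r)//= lerDl.
by apply: sumr_ge0 => s _; exact: softmax_ge0.
Qed.

(** Since probabilities are at most 1, the ratio bound gives a difference of at most e^(2d) - 1 <= 2
    d e^(2d). The a priori bound [D] on [d] makes the constant uniform. *)
Lemma softmax_lipschitz a b d D r : (forall s, `|a s - b s| <= d) -> d <= D ->
  `|softmax a r - softmax b r| <= 2 * expR (2 * D) * d.
Proof.
move=> abd dD.
have d0 : 0 <= d by apply: le_trans (abd r).
have step x y : 0 <= x -> y <= 1 -> 0 <= y -> x <= y * expR (2 * d) ->
    x - y <= 2 * expR (2 * D) * d.
  move=> x0 y1 y0 xy.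
  have h : 1 - 2 * d <= (expR (2 * d))^-1 by rewrite -expRN; exact: expR_ge1Dx.
  have h' : (1 - 2 * d) * expR (2 * d) <= 1.
    by rewrite -ler_pdivlMr ?expR_gt0// mul1r.
  have hD : expR (2 * d) <= expR (2 * D) by rewrite ler_expR; lra.
  have e1 : 1 <= expR (2 * d) by have := expR_ge1Dx (2 * d); lra.
  have : y * (expR (2 * d) - 1) <= 1 * (expR (2 * d) - 1).
    by rewrite ler_wpM2r// subr_ge0.
  nra.
rewrite ler_norml lerNl opprB; apply/andP; split.
  apply: step; rewrite ?softmax_ge0 ?softmax_le1//.
  by apply: softmax_le_expR => s; rewrite distrC.
by apply: step; rewrite ?softmax_ge0 ?softmax_le1//; exact: softmax_le_expR.
Qed.

Lemma softmax_ge a G r : (forall s, `|a s| <= G) ->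
  expR (- (2 * G)) / #|T|%:R <= softmax a r.
Proof.
move=> aG; rewrite /softmax.
have T0 : 0 < #|T|%:R :> R by rewrite ltr0n; apply/card_gt0P; exists t0.
rewrite ler_pdivlMr ?sum_expR_gt0// mulrAC ler_pdivrMr//.
have -> : - (2 * G) = - G - G by ring.
rewrite expRD -mulrA; apply: ler_pM; rewrite ?expR_ge0//.
- by rewrite mulr_ge0 ?expR_ge0// ltW// sum_expR_gt0.
- by rewrite ler_expR; have := aG r; rewrite ler_norml => /andP[].
rewrite expRN mulrC ler_pdivrMr ?expR_gt0// mulr_natl -sumr_const.
by apply: ler_sum => s _; rewrite ler_expR; have := aG s; rewrite ler_norml => /andP[].
Qed.

End Softmax.

(** * Conditional laws of the Potts model *)

Lemma sum_indicator (R : realType) (T : finType) (F : T -> R) (a : T) :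
  \sum_r F r * (a == r)%:R = F a.
Proof.
rewrite (bigD1 a)//= eqxx mulr1 big1 ?addr0// => r.
by rewrite eq_sym => /negPf ->; rewrite mulr0.
Qed.

Section Resampling.
Context {q N : nat}.
Implicit Types (x : config q N) (k j : 'I_N) (s u : 'I_q).

Definition upd x k s : config q N := [ffun i => if i == k then s else x i].

Lemma updE x k s i : upd x k s i = if i == k then s else x i.
Proof. by rewrite ffunE. Qed.

Lemma upd_eq x k s : upd x k s k = s.
Proof. by rewrite updE eqxx. Qed.

Lemma upd_upd x k s u : upd (upd x k s) k u = upd x k u.
Proof. by apply/ffunP => i; rewrite !updE; case: eqP. Qed.

Lemma upd_id x k : upd x k (x k) = x.
Proof. by apply/ffunP => i; rewrite !updE; case: eqP => // ->. Qed.

Lemma upd_comm x j k s u : j != k -> upd (upd x k s) j u = upd (upd x j u) k s.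
Proof.
move=> jk; apply/ffunP => i; rewrite !updE.
by case: (eqVneq i j) => // ->; rewrite (negPf jk).
Qed.

End Resampling.

Section PottsConditional.
Context {R : realType} {q N : nat} (A : 'M[R]_N).
Hypothesis A_sym : A^T = A.
Hypothesis A_diag : forall i, A i i = 0.
Hypothesis A_ge0 : forall i j, 0 <= A i j.
Variable r0 : 'I_q.
Implicit Types (x : config q N) (k j : 'I_N) (s u : 'I_q) (t : params R q).

(** Linear in [t]: at the true parameter it is the log conditional weight of color [r] at site [i],
    and at an increment [w] it is f_i(r). *)
Definition cond_energy t x i r : R :=
  t.1 * local_field A x i r + ext_field t.2 r.

Definition cond_prob t x i : 'I_q -> R := softmax (cond_energy t x i).

(** The conditional expectation of [h] under the Potts law given all coordinates except [j]. *)
Definition resample t (h : config q N -> R) j x : R :=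
  mean (cond_prob t x j) (fun s => h (upd x j s)).

Lemma A_symE i j : A i j = A j i.
Proof. by rewrite -{1}A_sym mxE. Qed.

Lemma local_field_upd_diff x i k r s :
  `|local_field A x i r - local_field A (upd x k s) i r| <= A i k.
Proof.
rewrite /local_field -sumrB (bigD1 k)//= big1 ?addr0; last first.
  by move=> j /negPf jk; rewrite updE jk subrr.
rewrite -mulrBr normrM ger0_norm// ler_piMr// ler_norml.
by case: eqP => _; case: eqP => _; rewrite /=; lra.
Qed.

Lemma local_field_upd x k r s : local_field A (upd x k s) k r = local_field A x k r.
Proof.
apply/esym/eqP; rewrite -subr_eq0 -normr_le0 -(A_diag k).
exact: local_field_upd_diff.
Qed.

Lemma cond_prob_upd t x k s : cond_prob t (upd x k s) k = cond_prob t x k.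
Proof.
rewrite /cond_prob; congr softmax; apply/funext => r.
by rewrite /cond_energy local_field_upd.
Qed.

(** By symmetry and the zero diagonal every pair containing [k] is counted twice, which cancels the
    factor 1/2; [c] collects the terms that do not involve [k]. *)
Lemma potts_weightE t x k : exists c : R,
  forall s, potts_weight A t (upd x k s) = expR (cond_energy t x k s) * expR c.
Proof.
exists (t.1 / 2 * (\sum_(i < N | i != k) \sum_(j < N | j != k)
          A i j * (x i == x j)%:R)
        + \sum_(i < N | i != k) ext_field t.2 (x i)) => s.
rewrite -expRD; congr expR; set y := upd x k s.
have yk : y k = s by exact: upd_eq.
have yN i : i != k -> y i = x i by rewrite /y updE => /negPf ->.
have fieldE : local_field A x k s = local_field A y k s by rewrite local_field_upd.
have -> : \sum_(i < N) \sum_(r < q) ext_field t.2 r * (y i == r)%:R =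
    ext_field t.2 s + \sum_(i < N | i != k) ext_field t.2 (x i).
  rewrite (bigD1 k)//= sum_indicator yk; congr (_ + _).
  by apply: eq_bigr => i ik; rewrite sum_indicator yN.
have -> : \sum_(i < N) \sum_(j < N) A i j * (y i == y j)%:R =
    2 * local_field A x k s + \sum_(i < N | i != k) \sum_(j < N | j != k)
          A i j * (x i == x j)%:R.
  rewrite (bigD1 k)//=.
  have -> : \sum_(j < N) A k j * (y k == y j)%:R = local_field A x k s.
    by rewrite fieldE /local_field yk; apply: eq_bigr => j _; rewrite eq_sym.
  have -> : \sum_(i < N | i != k) \sum_(j < N) A i j * (y i == y j)%:R =
      \sum_(i < N | i != k) A k i * (y i == s)%:R +
      \sum_(i < N | i != k) \sum_(j < N | j != k) A i j * (x i == x j)%:R.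
    rewrite -big_split; apply: eq_bigr => i ik /=.
    rewrite (bigD1 k)//= yk A_symE; congr (_ + _).
    by apply: eq_bigr => j jk; rewrite !yN.
  have -> : \sum_(i < N | i != k) A k i * (y i == s)%:R = local_field A x k s.
    by rewrite fieldE /local_field [RHS](bigD1 k)//= A_diag mul0r add0r.
  by rewrite addrA mulr_natl mulr2n.
by rewrite /cond_energy; field.
Qed.

Lemma potts_weight_gt0 t x : 0 < potts_weight A t x.
Proof. exact: expR_gt0. Qed.

Lemma potts_Z_gt0 t : 0 < potts_Z A t.
Proof.
rewrite /potts_Z (bigD1 [ffun=> r0])//= ltr_wpDr ?potts_weight_gt0//.
by apply: sumr_ge0 => x _; exact/ltW/potts_weight_gt0.
Qed.

Lemma potts_ge0 t x : 0 <= potts A t x.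
Proof. by rewrite divr_ge0// ltW ?potts_weight_gt0 ?potts_Z_gt0. Qed.

Lemma potts_sum t : \sum_x potts A t x = 1.
Proof. by rewrite -mulr_suml divff// gt_eqF ?potts_Z_gt0. Qed.

(** Reversibility of single-site resampling: given the other coordinates, the weight is proportional
    to the conditional law at [k], so the product is symmetric in the old and the new color. *)
Lemma potts_detailed_balance t x k s :
  potts A t x * cond_prob t x k s = potts A t (upd x k s) * cond_prob t x k (x k).
Proof.
have [c cE] := potts_weightE t x k.
rewrite /potts /cond_prob /softmax -[in LHS](upd_id x k) !cE upd_id.
by ring.
Qed.

Lemma mean_resample t h k :
  mean (potts A t) (resample t h k) = mean (potts A t) h.
Proof.
rewrite /mean /resample /mean.
under eq_bigr => x _.
  rewrite big_distrr/=.
  under eq_bigr => s _ do rewrite mulrA potts_detailed_balance.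
  over.
rewrite pair_big/=.
(* The involution exchanges the current color at [k] with the proposed one. After reindexing, the
   proposed color occurs only in its conditional probability, which sums to 1. *)
pose swap (z : config q N * 'I_q) := (upd z.1 k z.2, z.1 k).
have swapK : involutive swap.
  by move=> [x s]; rewrite /swap/= upd_upd upd_eq upd_id.
rewrite (reindex_inj (inv_inj swapK))/=.
rewrite -(pair_big xpredT xpredT (fun x s => potts A t (upd (upd x k s) k (x k)) *
  cond_prob t (upd x k s) k (upd x k s k) * h (upd (upd x k s) k (x k))))/=.
apply: eq_bigr => x _.
under eq_bigr => s _ do rewrite upd_upd upd_id upd_eq cond_prob_upd mulrAC.
by rewrite -big_distrr/= (softmax_sum r0) mulr1.
Qed.

(** A factor that ignores coordinate [k] can be moved inside the resampling, so the claim is the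
    invariance [mean_resample] applied to the product of [h] and [g]. *)
Lemma mean_residual0 t h g k : (forall x s, g (upd x k s) = g x) ->
  mean (potts A t) (fun x => (h x - resample t h k x) * g x) = 0.
Proof.
move=> gk.
have -> : mean (potts A t) (fun x => (h x - resample t h k x) * g x) =
    mean (potts A t) (fun x => h x * g x) -
    mean (potts A t) (resample t (fun x => h x * g x) k).
  rewrite /mean -sumrB; apply: eq_bigr => x _; rewrite -mulrBr mulrBl.
  congr (_ * (_ - _)); rewrite /resample /mean big_distrl/=.
  by apply: eq_bigr => s _; rewrite gk mulrA.
by rewrite mean_resample subrr.
Qed.

End PottsConditional.

(** * Near-orthogonality of resampling residuals *)

Section Decorrelation.
Context {R : realType} {q N : nat} (A : 'M[R]_N).
Hypothesis A_sym : A^T = A.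
Hypothesis A_diag : forall i, A i i = 0.
Hypothesis A_ge0 : forall i j, 0 <= A i j.
Variables (C : R) (C_ge : forall i, \sum_j A i j <= C).
Variable r0 : 'I_q.
Variable t : params R q.
Implicit Types (x : config q N) (k j : 'I_N) (s u : 'I_q).

Lemma A_le_rowsum i j : A i j <= C.
Proof.
apply: le_trans (C_ge i); rewrite (bigD1 j)//= lerDl.
by apply: sumr_ge0.
Qed.

(** The l1-Lipschitz constant of a conditional law per unit of interaction: energies move by at most
    [|t.1| * A i k], which is at most [|t.1| * C], and there are [q] colors. *)
Definition prob_lip : R := q%:R * (2 * expR (2 * (`|t.1| * C)) * `|t.1|).

Lemma prob_lip_ge0 : 0 <= prob_lip.
Proof. by rewrite !mulr_ge0// expR_ge0. Qed.

Lemma cond_prob_lipschitz x i k u :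
  \sum_s `|cond_prob A t x i s - cond_prob A t (upd x k u) i s|
    <= prob_lip * A i k.
Proof.
have -> : prob_lip * A i k =
    \sum_(s < q) 2 * expR (2 * (`|t.1| * C)) * `|t.1| * A i k.
  by rewrite sumr_const card_ord /prob_lip -mulrA mulr_natl.
apply: ler_sum => s _; rewrite -mulrA.
apply: (softmax_lipschitz r0) => [r|]; last by rewrite ler_wpM2l ?A_le_rowsum.
rewrite /cond_energy opprD addrACA subrr addr0 -mulrBr normrM ler_wpM2l//.
exact: local_field_upd_diff.
Qed.

Section Residuals.
Variables (I : pred 'I_N) (J : 'I_N -> 'I_N) (h : 'I_N -> config q N -> R).
Variables (M : R) (L : 'I_N -> 'I_N -> R) (Lam Gam : R).
Hypothesis M_ge0 : 0 <= M.
Hypothesis h_le : forall i x, I i -> `|h i x| <= M.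
Hypothesis h_lip : forall i x k s, I i -> `|h i x - h i (upd x k s)| <= L i k.
Hypothesis L_sum : forall k, \sum_(i | I i) L i k <= Lam.
Hypothesis A_sum : forall k, \sum_(i | I i) A (J i) k <= Gam.

Let resid i x := h i x - resample A t (h i) (J i) x.

Let resid_le i x : I i -> `|resid i x| <= 2 * M.
Proof.
move=> Ii; apply: (le_trans (ler_normB _ _)); rewrite mulr_natl mulr2n lerD ?h_le//.
apply: mean_norm_le => [s||s]; [exact: softmax_ge0|exact: softmax_sum|exact: h_le].
Qed.

(** One [L i k] comes from [h i], a second from [h i] inside the resampling, and the last term from
    the change of the conditional law at [J i]. *)
Let resid_lip i x k u : I i ->
  `|resid i x - resid i (upd x k u)| <= 2 * L i k + M * prob_lip * A (J i) k.
Proof.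
move=> Ii.
have L0 : 0 <= L i k by exact: le_trans (h_lip x k u Ii).
have -> : resid i x - resid i (upd x k u) = (h i x - h i (upd x k u)) -
   (resample A t (h i) (J i) x - resample A t (h i) (J i) (upd x k u)).
  by rewrite /resid; ring.
apply: (le_trans (ler_normB _ _)); rewrite mulr_natl mulr2n -addrA lerD ?h_lip//.
(* Resampling at [k] itself forgets the update, so only the first contribution remains. *)
case: (eqVneq (J i) k) => [->|Jk].
  have -> : resample A t (h i) k (upd x k u) = resample A t (h i) k x.
    rewrite /resample cond_prob_upd//; apply: eq_bigr => s _.
    by rewrite upd_upd.
  by rewrite subrr normr0 A_diag mulr0 addr0.
have -> : resample A t (h i) (J i) x - resample A t (h i) (J i) (upd x k u) =
  mean (cond_prob A t x (J i))
    (fun s => h i (upd x (J i) s) - h i (upd (upd x (J i) s) k u)) +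
  \sum_s (cond_prob A t x (J i) s - cond_prob A t (upd x k u) (J i) s) *
    h i (upd (upd x (J i) s) k u).
  rewrite /resample /mean -sumrB -big_split; apply: eq_bigr => s _ /=.
  by rewrite upd_comm//; ring.
apply: (le_trans (ler_normD _ _)); apply: lerD.
  by apply: mean_norm_le => [s||s]; [exact: softmax_ge0|exact: softmax_sum|exact: h_lip].
apply: (le_trans (ler_norm_sum _ _ _)).
rewrite -mulrA; apply: le_trans (ler_wpM2l M_ge0 (cond_prob_lipschitz x (J i) k u)).
rewrite big_distrr/=; apply: ler_sum => s _.
by rewrite normrM mulrC ler_wpM2r// h_le.
Qed.

(* The mean of [resid i * resid j] only sees the change of [resid j] when the
   coordinate [J i] is updated, since [resid i] is orthogonal to every function
   that does not depend on that coordinate. *)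
Lemma mean_sqr_residuals :
  mean (potts A t) (fun x => (\sum_(i | I i) resid i x) ^+ 2) <=
  N%:R * (2 * M * (2 * Lam + M * prob_lip * Gam)).
Proof.
have -> : mean (potts A t) (fun x => (\sum_(i | I i) resid i x) ^+ 2) =
    \sum_(i | I i) \sum_(j | I j) mean (potts A t) (fun x => resid i x * resid j x).
  rewrite /mean; under eq_bigr => x _.
    rewrite expr2 big_distrl big_distrr/=.
    under eq_bigr => i _ do rewrite big_distrr/= big_distrr/=.
    over.
  rewrite exchange_big; apply: eq_bigr => i Ii /=.
  by rewrite exchange_big.
have bound i j : I i -> I j -> mean (potts A t) (fun x => resid i x * resid j x) <=
    2 * M * (2 * L j (J i) + M * prob_lip * A (J j) (J i)).
  move=> Ii Ij.
  have -> : mean (potts A t) (fun x => resid i x * resid j x) =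
      mean (potts A t)
        (fun x => resid i x * (resid j x - resid j (upd x (J i) r0))).
    have /eqP := @mean_residual0 R q N A A_sym A_diag A_ge0 r0 t (h i)
      (fun x => resid j (upd x (J i) r0)) (J i)
      (fun x s => congr1 (resid j) (upd_upd _ _ _ _)).
    rewrite -[X in _ -> X = _]subr0 => /eqP <-.
    by rewrite /mean -sumrB; apply: eq_bigr => x _; rewrite -mulrBr -mulrBr.
  apply: (le_trans (ler_norm _)).
  apply: mean_norm_le => [x||x]; [exact: potts_ge0|exact: potts_sum|].
  by rewrite normrM ler_pM// ?resid_le ?resid_lip.
(* For fixed [i], the hypotheses [L_sum] and [A_sum] at the site [J i] bound the sum over all [j];
   hence the double sum is of order N and not N^2. *)
apply: (@le_trans _ _ (\sum_(i | I i) 2 * M * (2 * Lam + M * prob_lip * Gam))).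
  apply: ler_sum => i Ii; apply: le_trans (ler_sum _ (fun j => bound i j Ii)) _.
  rewrite -big_distrr/= ler_wpM2l ?mulr_ge0// big_split/= -!big_distrr/=.
  by rewrite lerD// ler_wpM2l// mulr_ge0// prob_lip_ge0.
rewrite sumr_const -[leLHS]mulr_natl.
have cardI : (#|I| <= N)%N by rewrite -[leqRHS]card_ord max_card.
(* The signs of [Lam] and [Gam] follow from their hypotheses only when a site exists; for N = 0 both
   sides vanish. *)
have [N0|N_gt0] := posnP N.
  by move: cardI; rewrite [in X in (_ <= X)%N]N0 leqn0 => /eqP ->; rewrite N0 !mul0r.
rewrite ler_wpM2r ?ler_nat//.
pose k := Ordinal N_gt0.
rewrite !(mulr_ge0, addr_ge0)// ?prob_lip_ge0//.
  apply: le_trans (L_sum k); apply: sumr_ge0 => i Ii.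
  by apply: le_trans (h_lip [ffun=> r0] k r0 Ii).
by apply: le_trans (A_sum k); apply: sumr_ge0.
Qed.

End Residuals.
End Decorrelation.

(** * Scores and spread of the local fields *)

Lemma variance_le_mean_sqr (R : realType) (T : finType) (p : T -> R)
    (p_sum : \sum_r p r = 1) (f : T -> R) :
  variance p f <= mean p (fun r => f r ^+ 2).
Proof.
have -> : variance p f =
    mean p (fun r => f r ^+ 2 + (- (2 * mean p f) * f r + mean p f ^+ 2)).
  by apply: eq_bigr => r _; congr (_ * _); ring.
rewrite (meanD p (fun r => f r ^+ 2)) gerDl meanD meanZ mean_cst//.
have := sqr_ge0 (mean p f); nra.
Qed.

Section Scores.
Context {R : realType} {q N : nat} (A : 'M[R]_N).
Hypothesis A_sym : A^T = A.
Hypothesis A_diag : forall i, A i i = 0.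
Hypothesis A_ge0 : forall i j, 0 <= A i j.
Variables (C : R) (C_gt0 : 0 < C) (C_ge : forall i, \sum_j A i j <= C).
Variable r0 : 'I_q.
Variable t : params R q.
Implicit Types (x : config q N) (i j k : 'I_N) (r s : 'I_q).

Lemma colsum_le k : \sum_i A i k <= C.
Proof.
apply: le_trans (C_ge k); rewrite le_eqVlt; apply/orP; left; apply/eqP.
by apply: eq_bigr => i _; rewrite (A_symE A_sym).
Qed.

Lemma local_field_ge0 x i r : 0 <= local_field A x i r.
Proof. by apply: sumr_ge0 => j _; rewrite mulr_ge0. Qed.

Lemma local_field_le x i r : local_field A x i r <= C.
Proof.
apply: le_trans (C_ge i); apply: ler_sum => j _.
by rewrite ler_piMr//; case: eqP.
Qed.

Lemma local_field_norm x i r : `|local_field A x i r| <= C.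
Proof. by rewrite ger0_norm ?local_field_ge0 ?local_field_le. Qed.

(** The derivative in beta of the log pseudo-likelihood at [t]. Its summands are residuals with J(i)
    = i, because the local field at [i] does not depend on x_i. *)
Definition score_beta x : R :=
  \sum_i (local_field A x i (x i) - mean (cond_prob A t x i) (local_field A x i)).

Definition score_field r x : R :=
  \sum_i ((x i == r)%:R - cond_prob A t x i r).

Lemma sum_eq_le (c : R) k : 0 <= c -> \sum_i c * (i == k)%:R <= c.
Proof.
move=> c0; rewrite (bigD1 k)//= eqxx mulr1 big1 ?addr0// => i /negPf ->.
by rewrite mulr0.
Qed.

Lemma mean_sqr_score_beta :
  mean (potts A t) (fun x => score_beta x ^+ 2) <=
  N%:R * (2 * C * (2 * (3 * C) + C * prob_lip C t * C)).
Proof.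
pose h i x := local_field A x i (x i).
(* Updating [k] other than [i] moves the local field by at most [A i k]; updating [i] switches the
   color at which it is read, a change of at most 2C. *)
pose L i k := A i k + (2 * C) * (i == k)%:R.
have hle i x : xpredT i -> `|h i x| <= C by rewrite local_field_norm.
have hlip i x k s : xpredT i -> `|h i x - h i (upd x k s)| <= L i k.
  move=> _; rewrite /h /L updE; case: (eqVneq i k) => [->|_].
    rewrite mulr1 A_diag add0r; apply: (le_trans (ler_normB _ _)).
    by rewrite mulr_natl mulr2n lerD// local_field_norm.
  by rewrite mulr0 addr0 local_field_upd_diff.
have Lsum k : \sum_(i | xpredT i) L i k <= 3 * C.
  have -> : 3 * C = C + 2 * C by ring.
  by rewrite big_split/= lerD ?colsum_le// sum_eq_le// mulr_ge0// ltW.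
apply: le_trans (mean_sqr_residuals A_sym A_diag A_ge0 C_ge r0 t (ltW C_gt0)
  hle hlip Lsum (J := id) (fun k => colsum_le k)).
rewrite le_eqVlt; apply/orP; left; apply/eqP; apply: eq_bigr => x _; congr (_ * _ ^+ 2).
apply: eq_bigr => i _; congr (_ - _); apply: eq_bigr => s _.
by rewrite /h upd_eq local_field_upd.
Qed.

Lemma mean_sqr_score_field r :
  mean (potts A t) (fun x => score_field r x ^+ 2) <=
  N%:R * (2 * 1 * (2 * 1 + 1 * prob_lip C t * C)).
Proof.
pose h i x : R := (x i == r)%:R.
pose L i k : R := 1 * (i == k)%:R.
have h01 b : `|(b : bool)%:R| <= 1 :> R by case: b; rewrite ?normr1 ?normr0.
have hle i x : xpredT i -> `|h i x| <= 1 by move=> _; exact: h01.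
have hlip i x k s : xpredT i -> `|h i x - h i (upd x k s)| <= L i k.
  move=> _; rewrite /h /L updE mul1r; case: (eqVneq i k) => [_|_]; last first.
    by rewrite subrr normr0.
  rewrite ler_norml.
  by case: (_ == _); case: (_ == _); rewrite /=; lra.
have Lsum k : \sum_(i | xpredT i) L i k <= 1 by rewrite sum_eq_le.
apply: le_trans (mean_sqr_residuals A_sym A_diag A_ge0 C_ge r0 t ler01
  hle hlip Lsum (J := id) (fun k => colsum_le k)).
rewrite le_eqVlt; apply/orP; left; apply/eqP; apply: eq_bigr => x _; congr (_ * _ ^+ 2).
apply: eq_bigr => i _; congr (_ - _).
rewrite /resample /mean -[LHS](@sum_indicator _ _ (cond_prob A t x i)).
by apply: eq_bigr => s _; rewrite /h upd_eq eq_sym.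
Qed.

Definition contrast ra rb i x : R := local_field A x i ra - local_field A x i rb.

Lemma contrast_norm ra rb i x : `|contrast ra rb i x| <= C.
Proof.
have := local_field_ge0 x i ra; have := local_field_ge0 x i rb.
have := local_field_le x i ra; have := local_field_le x i rb.
by rewrite ler_norml /contrast; lra.
Qed.

Lemma contrast_lip ra rb i x k s :
  `|contrast ra rb i x - contrast ra rb i (upd x k s)| <= 2 * A i k.
Proof.
have -> : contrast ra rb i x - contrast ra rb i (upd x k s) =
  (local_field A x i ra - local_field A (upd x k s) i ra)
  - (local_field A x i rb - local_field A (upd x k s) i rb).
  by rewrite /contrast; ring.
apply: (le_trans (ler_normB _ _)).
by rewrite mulr_natl mulr2n lerD// local_field_upd_diff.
Qed.

Variable eta : R.
Hypothesis eta_gt0 : 0 < eta.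

Definition has_strong_link i : bool := [exists j, eta <= A i j].

(** The value [i] at a site without a strong link is a mere default: the sums below run over
    [has_strong_link]. *)
Definition strong_link i : 'I_N := odflt i [pick j | eta <= A i j].

Lemma strong_linkP i : has_strong_link i -> eta <= A i (strong_link i).
Proof.
move=> /existsP[j Aij]; rewrite /strong_link.
by case: pickP => [//|/(_ j)]; rewrite Aij.
Qed.

(** Many sites may share one strong neighbour, but inserting the factor [A i (strong_link i) / eta]
    >= 1 bounds the sum by a column sum of the square of [A], divided by [eta]. *)
Lemma strong_link_sum k :
  \sum_(i | has_strong_link i) A (strong_link i) k <= C * C / eta.
Proof.
rewrite -ler_pdivrMr ?invr_gt0// invrK.
rewrite [leLHS]big_distrl/=.
apply: (@le_trans _ _ (\sum_i \sum_j A j k * A i j)).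
  rewrite [leRHS](bigID has_strong_link)/= -[leLHS]addr0 lerD//; last first.
    by apply: sumr_ge0 => i _; apply: sumr_ge0 => j _; rewrite mulr_ge0.
  apply: ler_sum => i Hi; rewrite (bigD1 (strong_link i))//=.
  rewrite -[leLHS]addr0 lerD ?ler_wpM2l ?strong_linkP//.
  by apply: sumr_ge0 => j _; rewrite mulr_ge0.
rewrite exchange_big/=.
apply: (@le_trans _ _ (\sum_j A j k * C)).
  by apply: ler_sum => j _; rewrite -big_distrr/= ler_wpM2l// colsum_le.
by rewrite -big_distrl/= ler_wpM2r ?colsum_le// ltW.
Qed.

(** A site without a strong link contributes at most C eta = c/2 to the sum of squares, which leaves
    cN/2 for the others, at most C^2 each. *)
Lemma card_strong_link (c : R) : eta = c / (2 * C) ->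
  c * N%:R <= \sum_i \sum_j A i j ^+ 2 ->
  c * N%:R / (2 * C ^+ 2) <= #|[pred i | has_strong_link i]|%:R.
Proof.
move=> etaE sumsq.
rewrite ler_pdivrMr ?mulr_gt0 ?exprn_gt0//.
have : \sum_i \sum_j A i j ^+ 2 <=
    \sum_i ((has_strong_link i)%:R * C ^+ 2 + C * eta).
  apply: ler_sum => i _.
  have sqC : 0 <= C * eta by rewrite mulr_ge0// ltW.
  case: (boolP (has_strong_link i)) => [_|/existsPn weak].
    rewrite mul1r -[leLHS]addr0 lerD// expr2.
    apply: (@le_trans _ _ (\sum_j A i j * C)); last first.
      by rewrite -big_distrl/= ler_wpM2r// ltW.
    by apply: ler_sum => j _; rewrite expr2 ler_wpM2l// (A_le_rowsum A_ge0 C_ge).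
  rewrite mul0r add0r; apply: (@le_trans _ _ (\sum_j A i j * eta)); last first.
    by rewrite -big_distrl/= ler_wpM2r// ltW.
  apply: ler_sum => j _; rewrite expr2 ler_wpM2l//.
  by have := weak j; rewrite -ltNge => /ltW.
rewrite big_split/= sumr_const card_ord -big_distrl/= -natr_sum.
have -> : (\sum_i has_strong_link i = #|[pred i | has_strong_link i]|)%N.
  rewrite -sum1_card [RHS]big_mkcond/=; apply: eq_bigr => i _.
  by rewrite inE; case: has_strong_link.
have CE : C * eta = c / 2 by rewrite etaE; field; rewrite gt_eqF.
rewrite CE -mulr_natl => le2; move: (le_trans sumsq le2).
lra.
Qed.

(** * Lower bound on the spread of the contrasts *)

Section Spread.
Variables (ra rb : 'I_q).
Hypothesis rab : ra != rb.
Variable p0 : R.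
Hypothesis p0_ge0 : 0 <= p0.
Hypothesis p0_le : forall x i r, p0 <= cond_prob A t x i r.

Let D := contrast ra rb.

Lemma contrast_upd_diff i x k :
  D i (upd x k ra) - D i (upd x k rb) = 2 * A i k.
Proof.
rewrite /D /contrast /local_field -!sumrB (bigD1 k)//= big1 ?addr0; last first.
  by move=> j /negPf jk; rewrite !updE jk subrr.
by rewrite !upd_eq !eqxx (negPf rab) eq_sym (negPf rab)/=; ring.
Qed.

(** Since (u D + v)^2 = u^2 D^2 + 2 u v D + v^2, control of the residual sums of D and of D^2
    handles all [u] and [v] simultaneously. *)
Definition fluct1 x : R := \sum_(i | has_strong_link i)
  (D i x - resample A t (D i) (strong_link i) x).

Definition fluct2 x : R := \sum_(i | has_strong_link i)
  (D i x ^+ 2 - resample A t (fun x => D i x ^+ 2) (strong_link i) x).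

Lemma mean_sqr_fluct1 : mean (potts A t) (fun x => fluct1 x ^+ 2) <=
  N%:R * (2 * C * (2 * (2 * C) + C * prob_lip C t * (C * C / eta))).
Proof.
apply: (@mean_sqr_residuals _ _ _ _ A_sym A_diag A_ge0 _ C_ge r0 t
  has_strong_link strong_link D _ (fun i k => 2 * A i k)).
- exact: ltW.
- by move=> i x _; exact: contrast_norm.
- by move=> i x k s _; exact: contrast_lip.
- move=> k; rewrite -big_distrr ler_wpM2l//; apply: le_trans (colsum_le k).
  by rewrite [leRHS](bigID has_strong_link)/= lerDl sumr_ge0.
- exact: strong_link_sum.
Qed.

Lemma mean_sqr_fluct2 : mean (potts A t) (fun x => fluct2 x ^+ 2) <=
  N%:R * (2 * C ^+ 2 * (2 * (4 * C * C) + C ^+ 2 * prob_lip C t * (C * C / eta))).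
Proof.
apply: (@mean_sqr_residuals _ _ _ _ A_sym A_diag A_ge0 _ C_ge r0 t
  has_strong_link strong_link (fun i x => D i x ^+ 2) _ (fun i k => 4 * C * A i k)).
- by rewrite exprn_ge0// ltW.
- by move=> i x _; rewrite normrX lerXn2r ?nnegrE ?contrast_norm// ltW.
- move=> i x k s _; rewrite subr_sqr normrM.
  have -> : 4 * C * A i k = (2 * A i k) * (2 * C) by ring.
  rewrite ler_pM ?contrast_lip//; apply: (le_trans (ler_normD _ _)).
  by rewrite mulr_natl mulr2n lerD// contrast_norm.
- move=> k; have C4 : 0 <= 4 * C by rewrite mulr_ge0// ltW.
  rewrite -big_distrr ler_wpM2l//; apply: le_trans (colsum_le k).
  by rewrite [leRHS](bigID has_strong_link)/= lerDl sumr_ge0.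
- exact: strong_link_sum.
Qed.

(* The colors [ra] and [rb] at the strong neighbour of [i] give values of [D i]
   that differ by at least [2 * eta], whatever [v] is. *)
Lemma resample_contrast_ge (u v : R) i x : has_strong_link i ->
  2 * p0 * eta ^+ 2 * u ^+ 2 <=
  u ^+ 2 * resample A t (fun x => D i x ^+ 2) (strong_link i) x
  + 2 * u * v * resample A t (D i) (strong_link i) x + v ^+ 2.
Proof.
move=> Hi; set k := strong_link i; set p := cond_prob A t x k.
have psum : \sum_r p r = 1 by exact: softmax_sum.
have -> : u ^+ 2 * resample A t (fun x => D i x ^+ 2) k x
    + 2 * u * v * resample A t (D i) k x + v ^+ 2 =
    mean p (fun s => (u * D i (upd x k s) + v) ^+ 2).
  rewrite -(mean_cst psum (v ^+ 2)) /resample -meanZ -meanZ -meanD -meanD.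
  by apply: eq_bigr => s _; congr (_ * _); ring.
apply: le_trans (variance_le_mean_sqr psum _).
have pge s : p0 <= p s by exact: p0_le.
have p_ge0 s : 0 <= p s by exact: softmax_ge0.
apply: le_trans (variance_ge p_ge0 _ ra rb pge p0_ge0).
have -> : u * D i (upd x k ra) + v - (u * D i (upd x k rb) + v) = u * (2 * A i k).
  by rewrite -(contrast_upd_diff i x k); ring.
have -> : p0 / 2 * (u * (2 * A i k)) ^+ 2 = 2 * p0 * A i k ^+ 2 * u ^+ 2 by field.
rewrite ler_wpM2r ?sqr_ge0// ler_wpM2l ?mulr_ge0//.
by rewrite lerXn2r ?nnegrE ?strong_linkP// ltW.
Qed.

(** If |v| <= 2C|u|, the cross term is of order u^2 and the fluctuations cost at most (1 + 4C) del N
    u^2 against the resampled second moments. If |v| is larger, then |u D_i + v| >= C|u| at every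
    site. *)
Lemma sum_sqr_contrast_ge (kap del c1 u v : R) x :
  0 <= del -> 2 * c1 + 2 * (1 + 4 * C) * del <= 2 * kap -> c1 <= C ^+ 2 ->
  kap * N%:R <= 2 * p0 * eta ^+ 2 * #|[pred i | has_strong_link i]|%:R ->
  `|fluct1 x| <= del * N%:R -> `|fluct2 x| <= del * N%:R ->
  c1 * N%:R * u ^+ 2 <= \sum_i (u * D i x + v) ^+ 2.
Proof.
move=> del0 kap_ge c1C cardI f1 f2.
case: (leP `|v| (2 * C * `|u|)) => [vu|uv].
  apply: (@le_trans _ _ (\sum_(i | has_strong_link i) (u * D i x + v) ^+ 2));
    last first.
    rewrite [leRHS](bigID has_strong_link)/= lerDl.
    by apply: sumr_ge0 => i _; exact: sqr_ge0.
  have : \sum_(i | has_strong_link i) 2 * p0 * eta ^+ 2 * u ^+ 2 <=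
      \sum_(i | has_strong_link i) (u * D i x + v) ^+ 2
      - u ^+ 2 * fluct2 x - 2 * u * v * fluct1 x.
    rewrite /fluct1 /fluct2 2!big_distrr/= -sumrB -sumrB.
    apply: ler_sum => i Hi; apply: le_trans (resample_contrast_ge u v x Hi) _.
    by rewrite le_eqVlt; apply/orP; left; apply/eqP; ring.
  rewrite sumr_const -[_ *+ _]mulr_natl.
  have n0 : 0 <= N%:R :> R by [].
  have e2 : u ^+ 2 * fluct2 x >= - (u ^+ 2 * (del * N%:R)).
    rewrite -mulrN ler_wpM2l ?sqr_ge0//.
    by move: f2; rewrite ler_norml => /andP[].
  have e1 : 2 * u * v * fluct1 x >= - (4 * C * u ^+ 2 * (del * N%:R)).
    suff : `|2 * u * v * fluct1 x| <= 4 * C * u ^+ 2 * (del * N%:R).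
      by rewrite ler_norml => /andP[].
    rewrite normrM ler_pM// -mulrA !normrM ger0_norm//.
    have -> : 4 * C * u ^+ 2 = 2 * (`|u| * (2 * C * `|u|)).
      by rewrite -(real_normK (num_real u)); ring.
    by rewrite ler_wpM2l// ler_wpM2l.
  have u2 := sqr_ge0 u.
  have := ler_wpM2r u2 cardI.
  have : (2 * c1 + 2 * (1 + 4 * C) * del) * (N%:R * u ^+ 2) <=
    2 * kap * (N%:R * u ^+ 2) by rewrite ler_wpM2r// mulr_ge0.
  by lra.
have -> : c1 * N%:R * u ^+ 2 = \sum_(i < N) c1 * u ^+ 2.
  by rewrite sumr_const card_ord -[RHS]mulr_natl; ring.
apply: ler_sum => i _.
apply: (@le_trans _ _ (C ^+ 2 * u ^+ 2)); first by rewrite ler_wpM2r ?sqr_ge0.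
rewrite -exprMn -[leRHS](real_normK (num_real _)) -[leLHS](real_normK (num_real _)).
rewrite lerXn2r ?nnegrE// normrM gtr0_norm//.
have : `|u * D i x| <= `|u| * C by rewrite normrM ler_wpM2l// contrast_norm.
have : `|v| <= `|u * D i x + v| + `|u * D i x|.
  by have := ler_normB (u * D i x + v) (u * D i x); rewrite addrC addKr.
by lra.
Qed.

End Spread.
End Scores.

(** * Concavity of the log pseudo-likelihood *)

(* [G t] is a supergradient of [l] at [t]; strict concavity is encoded by the
   strict inequality. *)
Lemma concave_unique_maximizer (R : realType) (V : normedModType R)
    (l : V -> R) (G : V -> V -> R) (t0 : V) (rho : R) :
  0 < rho ->
  (forall t a w, G t (a *: w) = a * G t w) ->
  (forall t w, w != 0 -> l (t + w) < l t + G t w) ->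
  (forall w, `|w| = rho -> l (t0 + w) < l t0) ->
  (exists2 w1, `|w1| <= rho & forall w, `|w| <= rho -> l (t0 + w) <= l (t0 + w1)) ->
  exists2 t1, unique_maximizer l t1 & `|t1 - t0| <= rho.
Proof.
move=> rho0 GZ ltG sphere [w1 w1rho w1max].
have w1_max : maximizer l (t0 + w1).
  move=> t; pose w := t - t0.
  have -> : t = t0 + w by rewrite /w addrC subrK.
  have [|rhow] := leP `|w| rho; first exact: w1max.
  have w0 : w != 0 by rewrite -normr_gt0 (lt_trans rho0).
  have n0 : 0 < `|w| by rewrite normr_gt0.
  (* The point t0 + a w lies on the sphere between t0 and t0 + w. Weighting its supergradient bounds
     at these two ends by 1 - a and a cancels the linear terms. *)
  pose a := rho / `|w|.
  have a0 : 0 < a by rewrite divr_gt0.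
  have a1 : a < 1 by rewrite ltr_pdivrMr// mul1r.
  have az : l (t0 + a *: w) < l t0.
    by apply: sphere; rewrite normrZ gtr0_norm// divfK ?gt_eqF.
  have l0 : l t0 < l (t0 + a *: w) + - a * G (t0 + a *: w) w.
    rewrite -GZ; have := @ltG (t0 + a *: w) (- a *: w).
    by rewrite -addrA scaleNr subrr addr0; apply; rewrite oppr_eq0 scaler_eq0 gt_eqF.
  have lw : l (t0 + w) < l (t0 + a *: w) + (1 - a) * G (t0 + a *: w) w.
    rewrite -GZ; have := @ltG (t0 + a *: w) ((1 - a) *: w).
    rewrite -addrA -scalerDl subrKC scale1r; apply.
    by rewrite scaler_eq0 negb_or w0 andbT subr_eq0 gt_eqF.
  suff : l (t0 + w) < l t0.
    move=> ltl; apply: ltW (lt_le_trans ltl _).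
    by have := w1max 0; rewrite addr0 normr0; apply; exact: ltW.
  set z := l (t0 + a *: w) in az l0 lw; set g := G _ w in l0 lw.
  rewrite ltNge; apply/negP => ge.
  have : a * l (t0 + w) < a * (z + (1 - a) * g) by rewrite ltr_pM2l.
  have : (1 - a) * l t0 < (1 - a) * (z + - a * g) by rewrite ltr_pM2l// subr_gt0.
  have : a * l t0 <= a * l (t0 + w) by rewrite ler_pM2l.
  by lra.
exists (t0 + w1); last by rewrite addrC addKr.
split=> // u u_max; apply/eqP; apply: contraT => u1.
set t1 := t0 + w1 in w1_max u1.
(* Two distinct maximizers are m + d and m - d for their midpoint m; adding the strict supergradient
   bounds at m shows that m would beat them. *)
pose d := 2^-1 *: (u - t1); pose m := t1 + d.
have d0 : d != 0 by rewrite scaler_eq0 invr_eq0 pnatr_eq0 subr_eq0.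
have uE : u = m + d.
  rewrite /m /d -addrA -scalerDl; have -> : 2^-1 + 2^-1 = 1 :> R by field.
  by rewrite scale1r addrC subrK.
have t1E : t1 = m + -1 *: d by rewrite /m scaleN1r addrK.
have := ltG m d d0; have := ltG m (-1 *: d).
rewrite scaler_eq0 negb_or oppr_eq0 oner_eq0 d0 => /(_ isT).
rewrite -uE -t1E GZ; have := w1_max m; have := u_max m.
by lra.
Qed.

Lemma variance_const (R : realType) (T : finType) (p : T -> R) (f : T -> R) :
  \sum_r p r = 1 -> (forall r s, f r = f s) -> variance p f = 0.
Proof.
move=> p_sum f_const; apply: big1 => r _.
have -> : mean p f = f r.
  by rewrite -[RHS](mean_cst p_sum); apply: eq_bigr => s _; rewrite (f_const s r).
by rewrite subrr expr0n mulr0.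
Qed.

Section Likelihood.
Context {R : realType} {q N : nat} (A : 'M[R]_N).
Variable r0 : 'I_q.
Variable x : config q N.
Implicit Types (t w : params R q) (i : 'I_N) (r s : 'I_q).

Lemma ext_fieldD (B B' : 'rV[R]_(q.-1)) r :
  ext_field (B + B') r = ext_field B r + ext_field B' r.
Proof. by rewrite /ext_field; case: insubP => [j _ _|_]; rewrite ?mxE ?addr0. Qed.

Lemma ext_fieldZ a (B : 'rV[R]_(q.-1)) r :
  ext_field (a *: B) r = a * ext_field B r.
Proof. by rewrite /ext_field; case: insubP => [j _ _|_]; rewrite ?mxE ?mulr0. Qed.

Lemma cond_energyD t w i r :
  cond_energy A (t + w) x i r = cond_energy A t x i r + cond_energy A w x i r.
Proof. by rewrite /cond_energy ext_fieldD/= mulrDl addrACA. Qed.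

Lemma cond_energyZ a w i r :
  cond_energy A (a *: w) x i r = a * cond_energy A w x i r.
Proof. by rewrite /cond_energy ext_fieldZ/= mulrDr mulrA. Qed.

Lemma log_pseudolikelihoodE t : log_pseudolikelihood A x t =
  \sum_i (cond_energy A t x i (x i) - lse (cond_energy A t x i)).
Proof.
rewrite /log_pseudolikelihood big_distrr/= -big_split -sumrB.
by apply: eq_bigr => i _; rewrite !sum_indicator.
Qed.

(** The directional derivative of the log pseudo-likelihood at [t]. *)
Definition score t w : R :=
  \sum_i (cond_energy A w x i (x i) - mean (cond_prob A t x i) (cond_energy A w x i)).

(** Minus the second derivative of the log pseudo-likelihood at [t] in direction [w]. *)
Definition total_variance t w : R :=
  \sum_i variance (cond_prob A t x i) (cond_energy A w x i).

Lemma scoreZ t a w : score t (a *: w) = a * score t w.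
Proof.
rewrite /score big_distrr; apply: eq_bigr => i _ /=.
rewrite cond_energyZ mulrBr -meanZ; congr (_ - _).
by apply: eq_bigr => r _; rewrite cond_energyZ.
Qed.

Lemma scoreE t w :
  score t w = w.1 * score_beta A t x + \sum_r ext_field w.2 r * score_field A t r x.
Proof.
rewrite /score_beta /score_field big_distrr/=.
under [X in _ + X]eq_bigr => r _ do rewrite big_distrr/=.
rewrite [X in _ + X]exchange_big -big_split; apply: eq_bigr => i _ /=.
have -> : mean (cond_prob A t x i) (cond_energy A w x i) =
    w.1 * mean (cond_prob A t x i) (local_field A x i) +
    mean (cond_prob A t x i) (ext_field w.2).
  by rewrite -meanZ -meanD.
have -> : \sum_r ext_field w.2 r * ((x i == r)%:R - cond_prob A t x i r) =
    ext_field w.2 (x i) - mean (cond_prob A t x i) (ext_field w.2).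
  under eq_bigr => r _ do rewrite mulrBr.
  rewrite sumrB sum_indicator; congr (_ - _).
  by apply: eq_bigr => r _; rewrite mulrC.
by rewrite /cond_energy; ring.
Qed.

Lemma log_pseudolikelihood_shift t w :
  log_pseudolikelihood A x (t + w) = log_pseudolikelihood A x t +
    \sum_i (cond_energy A w x i (x i) -
      ln (mean (cond_prob A t x i) (fun r => expR (cond_energy A w x i r)))).
Proof.
rewrite !log_pseudolikelihoodE -big_split; apply: eq_bigr => i _ /=.
have -> : lse (cond_energy A (t + w) x i) =
    lse (fun r => cond_energy A t x i r + cond_energy A w x i r).
  by congr lse; apply/funext => r; exact: cond_energyD.
by rewrite (lseD r0) cond_energyD /cond_prob; ring.
Qed.

Lemma log_pseudolikelihood_quadratic t w :
  (forall i r, `|cond_energy A w x i r| <= 1) ->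
  log_pseudolikelihood A x (t + w) <=
    log_pseudolikelihood A x t + score t w - total_variance t w / 8.
Proof.
move=> w1; rewrite log_pseudolikelihood_shift -[leRHS]addrA lerD2l.
rewrite /score /total_variance big_distrl/= -sumrB; apply: ler_sum => i _.
have p_ge0 s : 0 <= cond_prob A t x i s by exact: softmax_ge0.
have p_sum : \sum_s cond_prob A t x i s = 1 by exact: softmax_sum.
have := mean_variance_le_ln_mean_expR p_ge0 p_sum (w1 i).
by lra.
Qed.

(** Positive variance at one [t'] means that the energy of [w] at some site is not constant in the
    color. This property does not involve the parameter, so strict concavity along [w] follows at
    every [t]. *)
Lemma log_pseudolikelihood_tangent t t' w : 0 < total_variance t' w ->
  log_pseudolikelihood A x (t + w) < log_pseudolikelihood A x t + score t w.
Proof.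
move=> var_gt0; rewrite log_pseudolikelihood_shift ltrD2l.
have p_gt0 i s : 0 < cond_prob A t x i s by exact: softmax_gt0.
have p_sum i : \sum_s cond_prob A t x i s = 1 by exact: softmax_sum.
have [/existsP[i /existsP[r /existsP[s neq]]]|] :=
  boolP [exists i, exists r, exists s, cond_energy A w x i r != cond_energy A w x i s].
  rewrite /score (bigD1 i)//= [ltRHS](bigD1 i)//=; apply: ltr_leD.
    rewrite ltrD2l ltrN2; apply: mean_lt_ln_mean_expR neq => //.
    by move=> u; exact/ltW.
  apply: ler_sum => j _; rewrite lerD2l lerN2; apply: mean_le_ln_mean_expR => // u.
  exact/ltW.
move=> allconst; move: var_gt0; rewrite /total_variance big1 ?ltxx// => i _.
apply: variance_const; first exact: softmax_sum.
move=> r s; apply/eqP; apply: contraNT allconst => neq.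
by apply/existsP; exists i; apply/existsP; exists r; apply/existsP; exists s.
Qed.

Lemma log_pseudolikelihood_continuous :
  continuous (log_pseudolikelihood A x : params R q -> R).
Proof.
have ext_cont r : continuous (fun t : params R q => ext_field t.2 r).
  move=> t; rewrite /ext_field; case: insub => [j|]; last exact: cvg_cst.
  apply: (@continuous_comp _ _ _ snd (fun B : 'rV[R]_(q.-1) => B ord0 j)).
    exact: cvg_snd.
  exact: coord_continuous.
have energy_cont i r : continuous (fun t : params R q => cond_energy A t x i r).
  move=> t; apply: cvgD; last exact: ext_cont.
  by apply: cvgM; [exact: cvg_fst|exact: cvg_cst].
have sum_cont (I : finType) (f : I -> params R q -> R) :
    (forall k, continuous (f k)) -> continuous (fun t => \sum_k f k t).
  by move=> fc; apply: continuous_big => //; exact: add_continuous.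
have lse_cont i : continuous (fun t : params R q => lse (cond_energy A t x i)).
  move=> t; apply: (@continuous_comp _ _ _
    (fun t : params R q => \sum_r expR (cond_energy A t x i r)) (@ln R)).
    apply: (sum_cont _ (fun r (t : params R q) => expR (cond_energy A t x i r))).
    move=> r u; apply: (@continuous_comp _ _ _
      (fun t : params R q => cond_energy A t x i r) (@expR R)).
      exact: energy_cont.
    exact: continuous_expR.
  exact/continuous_ln/(sum_expR_gt0 r0).
have -> : log_pseudolikelihood A x = fun t : params R q =>
    \sum_i (cond_energy A t x i (x i) - lse (cond_energy A t x i)).
  by apply/funext => t; exact: log_pseudolikelihoodE.
apply: (sum_cont _ (fun i (t : params R q) =>
  cond_energy A t x i (x i) - lse (cond_energy A t x i))) => i t.
by apply: cvgB; [exact: energy_cont|exact: lse_cont].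
Qed.

Lemma params_norm_le (w : params R q) (rho : R) : 0 <= rho ->
  (`|w| <= rho) = (`|w.1| <= rho) && [forall r, `|w.2 ord0 r| <= rho].
Proof.
move=> rho0; rewrite prod_normE ge_max; congr (_ && _).
rewrite [X in X <= _]/Num.Def.normr/= mx_normrE.
apply/bigmax_leP/forallP => [[_ le] r|le].
  exact: (le (ord0, r)).
by split=> // -[i r] _; rewrite ord1/=.
Qed.

Lemma compact_box (rho : R) : compact
  (`[- rho, rho]%classic `*`
   [set v : 'rV[R]_(q.-1) | forall j, v ord0 j \in `[- rho, rho]]).
Proof.
apply: compact_setX; first exact: segment_compact.
apply: (@rV_compact _ _ (fun=> `[- rho, rho]%classic)) => _.
exact: segment_compact.
Qed.

Lemma log_pseudolikelihood_max_ball (t0 : params R q) (rho : R) : 0 <= rho ->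
  exists2 w1 : params R q, `|w1| <= rho & forall w : params R q, `|w| <= rho ->
    log_pseudolikelihood A x (t0 + w) <= log_pseudolikelihood A x (t0 + w1).
Proof.
move=> rho0; have := @compact_box rho; set K := (X in compact X) => K_compact.
have KE (w : params R q) : (w \in K) = (`|w| <= rho).
  rewrite params_norm_le//; apply/idP/idP.
    rewrite inE => -[/= w1 w2]; rewrite ler_norml.
    move: w1; rewrite in_itv/= => ->; apply/forallP => r.
    by rewrite ler_norml; have := w2 r; rewrite in_itv.
  move=> /andP[w1 /forallP w2]; rewrite inE; split=> /=.
    by rewrite in_itv/= -ler_norml.
  by move=> r; rewrite in_itv/= -ler_norml.
have [||w1 w1K w1max] := @compact_EVT_max (params R q) R
  (fun w => log_pseudolikelihood A x (t0 + w)) K _ K_compact.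
- by exists 0; rewrite -inE KE normr0.
- apply: continuous_subspaceT => w.
  apply: (@continuous_comp _ _ _ (fun w : params R q => t0 + w)
    (log_pseudolikelihood A x)).
    by apply: cvgD; [exact: cvg_cst|exact: cvg_id].
  exact: log_pseudolikelihood_continuous.
by exists w1; [rewrite -KE|move=> w; rewrite -KE; exact: w1max].
Qed.

End Likelihood.

(** * Localization of the estimator *)

Lemma markov_mean (R : realType) (T : finType) (p Y : T -> R) (P : pred T) :
  (forall x, 0 <= p x) -> (forall x, 0 <= Y x) -> (forall x, P x -> 1 <= Y x) ->
  \sum_(x | P x) p x <= mean p Y.
Proof.
move=> p_ge0 Y_ge0 PY.
rewrite /mean [leRHS](bigID P)/= -[leLHS]addr0 lerD//.
  by apply: ler_sum => x Px; rewrite -[leLHS]mulr1 ler_wpM2l// PY.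
by apply: sumr_ge0 => x _; rewrite mulr_ge0.
Qed.

Lemma norm2_le (R : realType) (q : nat) (hq : (0 < q)%N) (w : params R q) :
  norm2 w <= q%:R * `|w|.
Proof.
have w0 : 0 <= `|w| by [].
have : `|w| <= `|w| by []; rewrite {1}params_norm_le// => /andP[w1 /forallP w2].
rewrite /norm2 -[leRHS]ger0_norm ?mulr_ge0// -sqrtr_sqr ler_wsqrtr//.
have sqr_le (y : R) : `|y| <= `|w| -> y ^+ 2 <= `|w| ^+ 2.
  by move=> yw; rewrite -(real_normK (num_real y)) lerXn2r ?nnegrE.
apply: (@le_trans _ _ (`|w| ^+ 2 + \sum_(r < q.-1) `|w| ^+ 2)).
  by rewrite lerD ?sqr_le//; apply: ler_sum => r _; exact: sqr_le.
rewrite sumr_const card_ord -mulrS prednK// -[leLHS]mulr_natl exprMn.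
by rewrite ler_wpM2r ?sqr_ge0// expr2 ler_peMr// ler1n.
Qed.

Section Localization.
Context {R : realType} {q N : nat} (hq : (2 <= q)%N) (A : 'M[R]_N).
Hypothesis A_sym : A^T = A.
Hypothesis A_diag : forall i, A i i = 0.
Hypothesis A_ge0 : forall i j, 0 <= A i j.
Variables (C : R) (C_gt0 : 0 < C) (C_ge : forall i, \sum_j A i j <= C).
Variable t0 : params R q.
Implicit Types (x : config q N) (w : params R q) (r : 'I_q).

Let q_gt0 : (0 < q)%N. Proof. exact: ltn_trans hq. Qed.

Definition first_color : 'I_q := Ordinal q_gt0.

Let lt_last : (q.-1 < q)%N. Proof. by rewrite prednK. Qed.

Definition last_color : 'I_q := Ordinal lt_last.

Lemma first_neq_last : first_color != last_color.
Proof. by rewrite -val_eqE /= neq_ltn -ltnS prednK ?hq. Qed.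

Lemma ext_field_last (B : 'rV[R]_(q.-1)) : ext_field B last_color = 0.
Proof. by rewrite /ext_field insubF//= ltnn. Qed.

Lemma ext_field_color (B : 'rV[R]_(q.-1)) (j : 'I_(q.-1)) :
  exists r, ext_field B r = B ord0 j.
Proof.
have jq : (j < q)%N by rewrite (leq_trans (ltn_ord j))// leq_pred.
exists (Ordinal jq); rewrite /ext_field /=.
by rewrite (insubT (fun n => (n < q.-1)%N) (ltn_ord j))/=; congr (B _ _); apply/val_inj.
Qed.

Lemma ext_field_norm w r : `|ext_field w.2 r| <= `|w|.
Proof.
have : `|w| <= `|w| by []; rewrite {1}params_norm_le// => /andP[_ /forallP w2].
by rewrite /ext_field; case: insubP => [j _ _|_]; rewrite ?normr0.
Qed.

Lemma cond_energy_norm x w i r : `|cond_energy A w x i r| <= `|w| * (C + 1).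
Proof.
have : `|w| <= `|w| by []; rewrite {1}params_norm_le// => /andP[w1 _].
rewrite mulrDr mulr1; apply: (le_trans (ler_normD _ _)).
by rewrite lerD ?ext_field_norm// normrM ler_pM// (local_field_norm A_ge0).
Qed.

Lemma score_le x w :
  score A x t0 w <= `|w| * (`|score_beta A t0 x| + \sum_r `|score_field A t0 r x|).
Proof.
have : `|w| <= `|w| by []; rewrite {1}params_norm_le// => /andP[w1 _].
rewrite scoreE mulrDr; apply: lerD.
  by apply: (le_trans (ler_norm _)); rewrite normrM ler_wpM2r.
rewrite big_distrr/=; apply: ler_sum => r _.
by apply: (le_trans (ler_norm _)); rewrite normrM ler_wpM2r// ext_field_norm.
Qed.

(** A lower bound for all conditional probabilities at the true parameter, independent of N. *)
Definition min_prob : R := expR (- (2 * (`|t0| * (C + 1)))) / q%:R.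

Lemma min_prob_gt0 : 0 < min_prob.
Proof. by rewrite divr_gt0 ?expR_gt0// ltr0n. Qed.

Lemma min_prob_le x i r : min_prob <= cond_prob A t0 x i r.
Proof.
rewrite /min_prob -[in X in _ / X](card_ord q).
by apply: (softmax_ge first_color) => s; exact: cond_energy_norm.
Qed.

(** The last color has field 0, so comparing it with color [r] yields the terms u D_i + B_r. The
    spread bound recovers the coordinate u, and then v^2 <= 2 (u D_i + v)^2 + 2 u^2 C^2 recovers
    each field coordinate. *)
Lemma total_variance_ge (c1 : R) x w : 0 < c1 -> (0 < N)%N ->
  (forall u v, c1 * N%:R * u ^+ 2 <=
     \sum_i (u * contrast A first_color last_color i x + v) ^+ 2) ->
  min_prob * c1 / (2 + 4 * c1 + 4 * C ^+ 2) * N%:R * `|w| ^+ 2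
    <= total_variance A x t0 w.
Proof.
move=> c1_gt0 N_gt0 spread; set V := total_variance _ _ _ _.
have n_gt0 : 0 < N%:R :> R by rewrite ltr0n.
have p_gt0 := min_prob_gt0; set p := min_prob in p_gt0 *.
have V_ge r : p / 2 *
    \sum_i (w.1 * contrast A r last_color i x + ext_field w.2 r) ^+ 2 <= V.
  rewrite big_distrr/=; apply: ler_sum => i _.
  have -> : w.1 * contrast A r last_color i x + ext_field w.2 r =
      cond_energy A w x i r - cond_energy A w x i last_color.
    by rewrite /cond_energy /contrast ext_field_last; ring.
  apply: variance_ge; [|by move=> s; exact: min_prob_le|exact: ltW].
  by move=> s; exact: (softmax_ge0 first_color).
have V_u : p * c1 * (N%:R * w.1 ^+ 2) <= 2 * V.
  have := V_ge first_color; have := spread w.1 (ext_field w.2 first_color).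
  move=> /(ler_wpM2l (ltW p_gt0)); lra.
have V0 : 0 <= V by apply: sumr_ge0 => i _; apply: variance_ge0 => s;
  exact: (softmax_ge0 first_color).
(* The term 2 serves the coordinate u; 4 c1 and 4 C^2 come from the two terms of the bound on
   v^2. *)
set d := 2 + 4 * c1 + 4 * C ^+ 2.
have d_gt0 : 0 < d by rewrite /d; have := exprn_gt0 2 C_gt0; lra.
have pc_gt0 : 0 < p * c1 by rewrite mulr_gt0.
have C2 : 0 < C ^+ 2 by rewrite exprn_gt0.
have V_v (j : 'I_(q.-1)) : p * c1 * (N%:R * w.2 ord0 j ^+ 2) <= d * V.
  have [r rE] := ext_field_color w.2 j.
  have := V_ge r; rewrite rE; set S := \sum_i _ => VS.
  have SE : N%:R * w.2 ord0 j ^+ 2 <= 2 * S + 2 * (N%:R * w.1 ^+ 2) * C ^+ 2.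
    have -> : 2 * S + 2 * (N%:R * w.1 ^+ 2) * C ^+ 2 = \sum_(i < N)
        (2 * (w.1 * contrast A r last_color i x + w.2 ord0 j) ^+ 2 +
         2 * w.1 ^+ 2 * C ^+ 2).
      rewrite big_split/= -big_distrr/= sumr_const card_ord -[X in _ = _ + X]mulr_natl.
      by congr (_ + _); ring.
    rewrite mulr_natl -[N in leLHS]card_ord -sumr_const; apply: ler_sum => i _.
    set e := contrast _ _ _ _ _.
    have : e ^+ 2 <= C ^+ 2.
      rewrite -(real_normK (num_real e)) lerXn2r ?nnegrE ?(ltW C_gt0)//.
      exact: (contrast_norm A_ge0 C_ge).
    move=> /(ler_wpM2l (sqr_ge0 w.1)) e2.
    have := sqr_ge0 (w.1 * e + (w.1 * e + w.2 ord0 j)); lra.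
  have pSE : p * c1 * (N%:R * w.2 ord0 j ^+ 2) <=
      p * c1 * (2 * S + 2 * (N%:R * w.1 ^+ 2) * C ^+ 2).
    by rewrite ler_wpM2l// ltW.
  have := ler_wpM2r (ltW C2) V_u; have := ler_wpM2l (ltW c1_gt0) VS.
  by rewrite /d; lra.
have V_u' : p * c1 * (N%:R * w.1 ^+ 2) <= d * V.
  apply: (le_trans V_u); rewrite ler_wpM2r// /d.
  by lra.
have bound y : p * c1 * (N%:R * y ^+ 2) <= d * V ->
    `|y| <= Num.sqrt (d * V / (p * c1 * N%:R)).
  move=> yV; rewrite -sqrtr_sqr ler_wsqrtr// ler_pdivlMr ?(mulr_gt0 pc_gt0)//.
  by rewrite (le_trans _ yV)// le_eqVlt; apply/orP; left; apply/eqP; ring.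
have : `|w| <= Num.sqrt (d * V / (p * c1 * N%:R)).
  rewrite params_norm_le ?sqrtr_ge0// bound//=; apply/forallP => j.
  exact/bound/V_v.
move=> w_le; have : `|w| ^+ 2 <= Num.sqrt (d * V / (p * c1 * N%:R)) ^+ 2.
  by rewrite lerXn2r ?nnegrE ?sqrtr_ge0.
rewrite sqr_sqrtr; last by rewrite divr_ge0 ?(mulr_ge0 (ltW _))// (mulr_ge0 (ltW pc_gt0)).
rewrite ler_pdivlMr ?(mulr_gt0 pc_gt0)// => le.
rewrite -(ler_pM2l d_gt0) (le_trans _ le)// le_eqVlt; apply/orP; left; apply/eqP.
by rewrite /d; field; rewrite gt_eqF.
Qed.

(** On the sphere of radius [rho] the score gains less than c2 N rho^2 / 8, which the curvature
    takes back. The condition on [rho * (C + 1)] keeps the energies in [-1, 1], as the quadratic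
    bound requires. *)
Lemma MPL_localization (c2 rho : R) x : 0 < c2 -> 0 < rho -> (0 < N)%N ->
  rho * (C + 1) <= 1 ->
  (forall w, c2 * N%:R * `|w| ^+ 2 <= total_variance A x t0 w) ->
  `|score_beta A t0 x| + \sum_r `|score_field A t0 r x| < c2 * N%:R * rho / 8 ->
  exists2 t1, unique_maximizer (log_pseudolikelihood A x) t1 & `|t1 - t0| <= rho.
Proof.
move=> c2_gt0 rho_gt0 N_gt0 rhoC var_ge score_lt.
have n_gt0 : 0 < N%:R :> R by rewrite ltr0n.
apply: (@concave_unique_maximizer R (R * 'rV[R]_(q.-1))%type
  (log_pseudolikelihood A x) (score A x) t0 rho rho_gt0).
- by move=> t a w; exact: scoreZ.
- move=> t w w0; apply: (@log_pseudolikelihood_tangent _ _ _ _ first_color _ _ t0).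
  apply: lt_le_trans (var_ge w).
  by rewrite (mulr_gt0 (mulr_gt0 c2_gt0 n_gt0))// exprn_gt0// normr_gt0.
- move=> w wrho.
  apply: (le_lt_trans (log_pseudolikelihood_quadratic first_color t0 _)).
    move=> i r; apply: (le_trans (cond_energy_norm _ _ _ _)).
    by rewrite wrho.
  have := score_le x w; have := var_ge w; rewrite wrho => vge sle.
  have : rho * (`|score_beta A t0 x| + \sum_r `|score_field A t0 r x|) <
     rho * (c2 * N%:R * rho / 8) by rewrite ltr_pM2l.
  by lra.
- exact: (log_pseudolikelihood_max_ball A first_color x t0 (ltW rho_gt0)).
Qed.

End Localization.

(** * Constants independent of N and the tail bound *)

Section TailBound.
Context {R : realType} {q : nat} (hq : (2 <= q)%N).
Variables (C c : R) (C_gt0 : 0 < C) (c_gt0 : 0 < c).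
Variable t0 : params R q.

Definition link_threshold : R := c / (2 * C).

(** The product 2 p eta^2 c / (2 C^2), with p the minimal probability, eta = c / (2C), and c / (2
    C^2) the guaranteed fraction of sites with a strong link. *)
Definition resample_rate : R := min_prob C t0 * c ^+ 3 / (4 * C ^+ 4).

(** The two entries of the minimum answer the two cases of [sum_sqr_contrast_ge]. *)
Definition spread_rate : R := Num.min (resample_rate / 2) (C ^+ 2).

(** Chosen so that the fluctuations consume at most half of [resample_rate]; [spread_rate] fits in
    the other half. *)
Definition fluct_tolerance : R := resample_rate / (2 * (1 + 4 * C)).

Definition curvature : R :=
  min_prob C t0 * spread_rate / (2 + 4 * spread_rate + 4 * C ^+ 2).

Definition score_var : R :=
  2 * C * (2 * (3 * C) + C * prob_lip C t0 * C)
  + q%:R * (2 * 1 * (2 * 1 + 1 * prob_lip C t0 * C)).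

Definition fluct_var : R :=
  2 * C * (2 * (2 * C) + C * prob_lip C t0 * (C * C / link_threshold))
  + 2 * C ^+ 2 * (2 * (4 * C * C) + C ^+ 2 * prob_lip C t0 * (C * C / link_threshold)).

Lemma link_threshold_gt0 : 0 < link_threshold.
Proof. by rewrite divr_gt0// mulr_gt0. Qed.

Lemma resample_rate_gt0 : 0 < resample_rate.
Proof.
have p_gt0 := min_prob_gt0 hq C t0.
apply: divr_gt0; first exact: mulr_gt0 p_gt0 (exprn_gt0 3 c_gt0).
exact: mulr_gt0 _ (exprn_gt0 4 C_gt0).
Qed.

Lemma spread_rate_gt0 : 0 < spread_rate.
Proof. by rewrite lt_min exprn_gt0// andbT divr_gt0// resample_rate_gt0. Qed.

Lemma fluct_tolerance_gt0 : 0 < fluct_tolerance.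
Proof. by rewrite divr_gt0 ?resample_rate_gt0//; have := C_gt0; lra. Qed.

Lemma curvature_gt0 : 0 < curvature.
Proof.
have p_gt0 := min_prob_gt0 hq C t0.
have s_gt0 := spread_rate_gt0; have C2 := exprn_gt0 2 C_gt0.
by apply: divr_gt0; [exact: mulr_gt0|lra].
Qed.

Variables (N : nat) (N_gt0 : (0 < N)%N) (A : 'M[R]_N).
Hypothesis A_sym : A^T = A.
Hypothesis A_diag : forall i, A i i = 0.
Hypothesis A_ge0 : forall i j, 0 <= A i j.
Hypothesis C_ge : forall i, \sum_j A i j <= C.
Hypothesis A_sumsq : c * N%:R <= \sum_i \sum_j A i j ^+ 2.

Let D1 := fluct1 A t0 link_threshold (first_color hq) (last_color hq).
Let D2 := fluct2 A t0 link_threshold (first_color hq) (last_color hq).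
Let score_sqr x : R :=
  score_beta A t0 x ^+ 2 + \sum_r score_field A t0 r x ^+ 2.

Lemma total_variance_lower_bound x w :
  `|D1 x| <= fluct_tolerance * N%:R -> `|D2 x| <= fluct_tolerance * N%:R ->
  curvature * N%:R * `|w| ^+ 2 <= total_variance A x t0 w.
Proof.
move=> D1_le D2_le.
apply: total_variance_ge => //; first exact: spread_rate_gt0.
move=> u v.
apply: (@sum_sqr_contrast_ge _ _ _ _ A_ge0 _ C_gt0 C_ge t0 _ link_threshold_gt0
  _ _ (first_neq_last hq) (min_prob C t0) _ _ resample_rate fluct_tolerance) => //.
- exact/ltW/min_prob_gt0.
- by move=> y i r; exact: min_prob_le.
- exact/ltW/fluct_tolerance_gt0.
- have -> : 2 * (1 + 4 * C) * fluct_tolerance = resample_rate.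
    by rewrite /fluct_tolerance; field; have := C_gt0; lra.
  have : spread_rate <= resample_rate / 2 by rewrite ge_min lexx.
  by lra.
- by rewrite ge_min lexx orbT.
- have := card_strong_link A_ge0 C_gt0 C_ge link_threshold_gt0 erefl A_sumsq.
  rewrite -/link_threshold => card_ge.
  have p_gt0 := min_prob_gt0 hq C t0.
  have h : 0 <= 2 * min_prob C t0 * link_threshold ^+ 2.
    exact: mulr_ge0 (mulr_ge0 (ler0n _ 2) (ltW p_gt0)) (sqr_ge0 _).
  apply: le_trans (ler_wpM2l h card_ge).
  rewrite le_eqVlt; apply/orP; left; apply/eqP.
  by rewrite /resample_rate /link_threshold; field; rewrite gt_eqF.
Qed.

(** The bound |s| <= (s^2/m + m)/2 is summed over the q + 1 scores. *)
Lemma sum_norm_score_le (m : R) x : 0 < m -> score_sqr x <= m ^+ 2 ->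
  `|score_beta A t0 x| + \sum_r `|score_field A t0 r x| <= (q%:R + 2) / 2 * m.
Proof.
move=> m_gt0 le_m.
have amgm (s : R) : `|s| <= (s ^+ 2 / m + m) / 2.
  have := sqr_ge0 (`|s| - m); rewrite sqrrB (real_normK (num_real s)) => h.
  have -> : (s ^+ 2 / m + m) / 2 = (s ^+ 2 + m ^+ 2) / m / 2.
    by field; rewrite gt_eqF.
  rewrite ler_pdivlMr// ler_pdivlMr//; lra.
apply: (@le_trans _ _ ((score_sqr x / m + (q%:R + 1) * m) / 2)).
  have -> : (score_sqr x / m + (q%:R + 1) * m) / 2 =
      (score_beta A t0 x ^+ 2 / m + m) / 2 +
      \sum_r (score_field A t0 r x ^+ 2 / m + m) / 2.
    rewrite -big_distrl/= big_split/= -big_distrl/= sumr_const card_ord.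
    by rewrite -[m *+ q]mulr_natl /score_sqr; field; rewrite gt_eqF.
  by rewrite lerD//; apply: ler_sum => r _.
have : score_sqr x / m <= m by rewrite ler_pdivrMr.
lra.
Qed.

(** [P] is any event excluded by a unique maximizer within [rho] of the truth; samples without a
    unique maximizer are thus counted as possibly bad. *)
Lemma MPL_tail_bound (Lam rho : R) (P : pred (config q N)) :
  0 < Lam -> 0 < rho -> rho * (C + 1) <= 1 ->
  (q%:R + 2) / 2 * (Lam * Num.sqrt N%:R) < curvature * N%:R * rho / 8 ->
  (forall x t1, unique_maximizer (log_pseudolikelihood A x) t1 ->
     `|t1 - t0| <= rho -> ~~ P x) ->
  \sum_(x | P x) potts A t0 x <=
    score_var / Lam ^+ 2 + fluct_var / (fluct_tolerance ^+ 2 * N%:R).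
Proof.
move=> Lam_gt0 rho_gt0 rhoC rho_large notP.
have n_gt0 : 0 < N%:R :> R by rewrite ltr0n.
have tol_gt0 := fluct_tolerance_gt0; set tol := fluct_tolerance in tol_gt0 *.
(* The weights are such that [Y x < 1] bounds the scores and both fluctuations at once; a single
   Markov inequality then replaces a union bound. *)
pose a := (Lam ^+ 2 * N%:R)^-1; pose b := ((tol * N%:R) ^+ 2)^-1.
have a_gt0 : 0 < a by rewrite invr_gt0 (mulr_gt0 (exprn_gt0 2 Lam_gt0)).
have b_gt0 : 0 < b by rewrite invr_gt0 (exprn_gt0 2 (mulr_gt0 tol_gt0 n_gt0)).
pose Y x := a * score_sqr x + b * (D1 x ^+ 2 + D2 x ^+ 2).
have sq_ge0 x : 0 <= score_sqr x.
  by rewrite addr_ge0 ?sqr_ge0//; apply: sumr_ge0 => r _; exact: sqr_ge0.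
have D_ge0 x : 0 <= D1 x ^+ 2 + D2 x ^+ 2 by rewrite addr_ge0 ?sqr_ge0.
have potts0 x : 0 <= potts A t0 x by exact: (potts_ge0 _ (first_color hq)).
apply: (@le_trans _ _ (mean (potts A t0) Y)).
  apply: markov_mean => // x.
    exact: addr_ge0 (mulr_ge0 (ltW a_gt0) _) (mulr_ge0 (ltW b_gt0) _).
  apply: contraTT; rewrite -ltNge => Y_lt1.
  have score_lt : score_sqr x <= (Lam * Num.sqrt N%:R) ^+ 2.
    rewrite exprMn sqr_sqrtr ?ler0n// -[leRHS]mulr1 -ler_pdivrMl; last first.
      exact: mulr_gt0 (exprn_gt0 2 Lam_gt0) n_gt0.
    rewrite -/a; apply: le_trans (ltW Y_lt1); rewrite lerDl.
    exact: mulr_ge0 (ltW b_gt0) _.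
  have D_lt : D1 x ^+ 2 + D2 x ^+ 2 <= (tol * N%:R) ^+ 2.
    rewrite -[leRHS]mulr1 -ler_pdivrMl; last first.
      exact: (exprn_gt0 2 (mulr_gt0 tol_gt0 n_gt0)).
    rewrite -/b; apply: le_trans (ltW Y_lt1); rewrite lerDr.
    exact: mulr_ge0 (ltW a_gt0) _.
  have tolN : 0 <= tol * N%:R by exact/ltW/mulr_gt0.
  have norm_le (d : R) : d ^+ 2 <= (tol * N%:R) ^+ 2 -> `|d| <= tol * N%:R.
    move=> d_le; rewrite -(ger0_norm tolN) -!sqrtr_sqr; exact: ler_wsqrtr.
  have D1_le : `|D1 x| <= tol * N%:R.
    by apply: norm_le; apply: le_trans D_lt; rewrite lerDl sqr_ge0.
  have D2_le : `|D2 x| <= tol * N%:R.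
    by apply: norm_le; apply: le_trans D_lt; rewrite lerDr sqr_ge0.
  have [|t1 t1_max t1_near] := @MPL_localization _ _ _ hq A A_ge0 _ C_ge t0
    _ _ x curvature_gt0 rho_gt0 N_gt0 rhoC
    (fun w => total_variance_lower_bound w D1_le D2_le).
    apply: le_lt_trans rho_large; apply: sum_norm_score_le => //.
    by rewrite mulr_gt0// sqrtr_gt0.
  exact: notP t1_max t1_near.
have -> : mean (potts A t0) Y =
    a * (mean (potts A t0) (fun x => score_beta A t0 x ^+ 2) +
         \sum_r mean (potts A t0) (fun x => score_field A t0 r x ^+ 2)) +
    b * (mean (potts A t0) (fun x => D1 x ^+ 2) +
         mean (potts A t0) (fun x => D2 x ^+ 2)).
  have -> : \sum_r mean (potts A t0) (fun x => score_field A t0 r x ^+ 2) =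
      mean (potts A t0) (fun x => \sum_r score_field A t0 r x ^+ 2).
    rewrite /mean exchange_big/=; apply: eq_bigr => x _.
    by rewrite big_distrr.
  by rewrite -!meanD -!meanZ -meanD.
have score_le : mean (potts A t0) (fun x => score_beta A t0 x ^+ 2) +
    \sum_r mean (potts A t0) (fun x => score_field A t0 r x ^+ 2) <=
    N%:R * score_var.
  rewrite mulrDr lerD ?(mean_sqr_score_beta _ _ _ _ _ (first_color hq))//.
  set v := 2 * 1 * _; have -> : N%:R * (q%:R * v) = \sum_(r < q) N%:R * v.
    by rewrite sumr_const card_ord -[RHS]mulr_natl mulrCA.
  by apply: ler_sum => r _; exact: mean_sqr_score_field.
have fluct_le : mean (potts A t0) (fun x => D1 x ^+ 2) +
    mean (potts A t0) (fun x => D2 x ^+ 2) <= N%:R * fluct_var.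
  rewrite mulrDr lerD//.
    exact: (mean_sqr_fluct1 _ _ _ _ _ (first_color hq) _ link_threshold_gt0).
  exact: (mean_sqr_fluct2 _ _ _ _ _ (first_color hq) _ link_threshold_gt0).
apply: le_trans (lerD (ler_wpM2l (ltW a_gt0) score_le)
  (ler_wpM2l (ltW b_gt0) fluct_le)) _.
rewrite le_eqVlt; apply/orP; left; apply/eqP; congr (_ + _).
  by rewrite /a; field; rewrite !gt_eqF.
by rewrite /b; field; rewrite !gt_eqF.
Qed.

End TailBound.

(** * Constants from the asymptotic hypotheses, and the rate *)

Lemma rowsum_bounded (R : realType) (A : forall N, 'M[R]_N) :
  (ereal_sup [set (\big[Num.max/0]_(i < N) \sum_(j < N) A N i j)%:E
             | N in [set N | (1 <= N)%N]] < +oo)%E ->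
  exists2 C : R, 0 < C & forall N (i : 'I_N), \sum_j A N i j <= C.
Proof.
set S := ereal_sup _ => S_fin.
have le_S N (i : 'I_N) : ((\sum_j A N i j)%:E <= S)%E.
  apply: (@le_trans _ _ (\big[Num.max/0]_(k < N) \sum_j A N k j)%:E).
    by rewrite lee_fin; exact: le_bigmax.
  apply: ereal_sup_ubound; exists N => //=.
  by case: N i => [[]|].
case: S S_fin le_S => [s|//|] _ le_S; last first.
  by exists 1 => // N i; have := le_S N i; rewrite leeNy_eq.
exists (Num.max s 1) => [|N i]; first by rewrite lt_max ltr01 orbT.
by rewrite le_max; have := le_S N i; rewrite lee_fin => ->.
Qed.

(** The lower limit is the supremum of the tail infima, so some tail infimum is positive; it is
    finite, being below a term of the real sequence. *)
Lemma limn_einf_gt0 (R : realType) (u : R^nat) :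
  (0 < limn_einf (fun n => (u n)%:E))%E ->
  exists2 c : R, 0 < c & \forall n \near \oo, c <= u n.
Proof.
rewrite limn_einf_lim (cvg_lim _ (@cvg_einfs_sup _ _))// => /ereal_sup_gt.
move=> [_ [n _ <-]] inf_gt0.
have inf_le m : (n <= m)%N -> (einfs (fun n => (u n)%:E) n <= (u m)%:E)%E.
  by move=> nm; apply: ereal_inf_lbound; exists m.
case: (einfs _ n) inf_gt0 inf_le => [c|/= _ inf_le|//]; last first.
  by have := inf_le n (leqnn n).
rewrite lte_fin => c_gt0 inf_le; exists c => //.
by near=> m; rewrite -lee_fin inf_le//; near: m; exact: nbhs_infty_ge.
Unshelve. all: by end_near.
Qed.

Theorem theorem1p3 (R : realType) (q : nat) (hq : (2 <= q)%N)
    (A : forall N, 'M[R]_N)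
    (A_sym : forall N, (A N)^T = A N)
    (A_diag : forall N (i : 'I_N), A N i i = 0)
    (A_ge0 : forall N (i j : 'I_N), 0 <= A N i j)
    (A_rowsum : (ereal_sup [set (\big[Num.max/0]_(i < N)
                                   \sum_(j < N) A N i j)%:E
                           | N in [set N | (1 <= N)%N]] < +oo)%E)
    (A_sum : (0 < limn_einf (fun N =>
                (N%:R^-1 * \sum_(i < N) \sum_(j < N) A N i j)%:E))%E)
    (A_sumsq : (0 < limn_einf (fun N =>
                  (N%:R^-1 * \sum_(i < N) \sum_(j < N) A N i j ^+ 2)%:E))%E)
    (beta : R) (B : 'rV[R]_(q.-1)) (hbeta : 0 < beta)
    (est : forall N, config q N -> params R q)
    (hest : is_MPL_estimator A est) :
  bigO_proba (T := config q)
    (fun N (x : config q N) => potts (A N) (beta, B) x)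
    (fun N (x : config q N) =>
       norm2 ((est N x).1 - beta, (est N x).2 - B))
    (fun N => (Num.sqrt N%:R)^-1).
Proof.
have [C C_gt0 C_ge] := rowsum_bounded A_rowsum.
have [c c_gt0 c_near] := limn_einf_gt0 A_sumsq.
move=> eps eps_gt0; pose t0 : params R q := (beta, B).
have c2_gt0 : 0 < curvature C c t0 by exact: curvature_gt0.
set c2 := curvature C c t0 in c2_gt0.
have tol_gt0 : 0 < fluct_tolerance C c t0 by exact: fluct_tolerance_gt0.
set tol := fluct_tolerance C c t0 in tol_gt0.
have q_gt0 : 0 < q%:R :> R by rewrite ltr0n (ltn_trans _ hq).
(* The summand 1 gives Lam <= Lam^2, so the score term of the tail bound is at most eps/2. *)
pose Lam := 1 + 2 * `|score_var C t0| / eps.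
have Lam_ge : 2 * `|score_var C t0| / eps <= Lam by rewrite lerDr.
have Lam_ge1 : 1 <= Lam.
  by rewrite lerDl; apply: divr_ge0 (ltW eps_gt0); apply: mulr_ge0.
have Lam_gt0 : 0 < Lam by exact: lt_le_trans ltr01 Lam_ge1.
(* With radius kap / sqrt N, the curvature side c2 N rho / 8 is exactly twice the bound (q + 2)/2
   Lam sqrt N on the scores. *)
pose kap := 8 * (q%:R + 2) * Lam / c2.
have kap_gt0 : 0 < kap.
  apply: divr_gt0 c2_gt0; apply: mulr_gt0 Lam_gt0; lra.
(* The factor q converts the sup norm into the Euclidean norm, as in [norm2_le]. *)
exists (q%:R * kap); first exact: mulr_gt0.
near=> N.
have N_gt0 : (0 < N)%N by near: N; exact: nbhs_infty_gt.
have n_gt0 : 0 < N%:R :> R by rewrite ltr0n.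
have sqrt_gt0 : 0 < Num.sqrt N%:R :> R by rewrite sqrtr_gt0.
have sqrtK : Num.sqrt N%:R * Num.sqrt N%:R = N%:R :> R.
  by rewrite -expr2 sqr_sqrtr// ltW.
have C1 : 0 <= C + 1 by have := C_gt0; lra.
have rho_small : kap / Num.sqrt N%:R * (C + 1) <= 1.
  rewrite mulrAC ler_pdivrMr// mul1r.
  rewrite -(@ger0_norm _ (kap * (C + 1))); last exact: mulr_ge0 (ltW kap_gt0) C1.
  rewrite -sqrtr_sqr; apply/ler_wsqrtr/ltW.
  by near: N; exact: nbhs_infty_gtr.
have fluct_small : fluct_var C c t0 / (tol ^+ 2 * N%:R) <= eps / 2.
  have tol2 : 0 < tol ^+ 2 by rewrite exprn_gt0.
  rewrite ler_pdivrMr; last exact: mulr_gt0.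
  have : `|fluct_var C c t0| / (eps / 2 * tol ^+ 2) < N%:R.
    by near: N; exact: nbhs_infty_gtr.
  rewrite ltr_pdivrMr; last by apply: mulr_gt0 tol2; exact: divr_gt0.
  move=> /ltW le; apply: le_trans (ler_norm _) (le_trans le _).
  by rewrite [leLHS]mulrC -[leLHS]mulrA.
have score_small : score_var C t0 / Lam ^+ 2 <= eps / 2.
  rewrite ler_pdivrMr ?exprn_gt0//; apply: le_trans (ler_norm _) _.
  move: Lam_ge; rewrite ler_pdivrMr// => h.
  have : 0 <= eps * Lam * (Lam - 1).
    by apply: mulr_ge0; [exact/ltW/mulr_gt0|rewrite subr_ge0].
  lra.
have sumsq : c * N%:R <= \sum_i \sum_j A N i j ^+ 2.
  rewrite -ler_pdivlMr// mulrC; near: N; exact: c_near.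
apply: (@le_trans _ _ (score_var C t0 / Lam ^+ 2 +
  fluct_var C c t0 / (tol ^+ 2 * N%:R))); last by lra.
apply: (@MPL_tail_bound R q hq C c C_gt0 c_gt0 t0 N N_gt0 (A N) (A_sym N)
  (A_diag N) (@A_ge0 N) (C_ge N) sumsq Lam (kap / Num.sqrt N%:R)) => //.
- exact: divr_gt0.
- rewrite -/c2 -[X in c2 * X]sqrtK.
  have -> : c2 * (Num.sqrt N%:R * Num.sqrt N%:R) * (kap / Num.sqrt N%:R) / 8 =
      (q%:R + 2) * (Lam * Num.sqrt N%:R).
    by rewrite /kap; field; rewrite !gt_eqF.
  by rewrite ltr_pM2r ?mulr_gt0//; lra.
move=> x t1 t1_max t1_near; rewrite (hest N x t1 t1_max) -leNgt.
rewrite ger0_norm ?sqrtr_ge0// gtr0_norm ?invr_gt0// -mulrA.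
apply: le_trans (norm2_le (ltnW hq) (t1 - t0)) _.
by rewrite ler_pM2l.
Unshelve. all: by end_near.
Qed.
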